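(* Let $X_1,\dots,X_p$ be independent random variables, $X_i$ valued in a measurable space $E_i$, let $f:E_1\times\dots\times E_p\to\mathbb R^k$ be measurable, let $Y=f(X_1,\dots,X_p)$ have positive definite covariance matrix $\Sigma$, and let $\mathbf u\subset\{1,\dots,p\}$. Assume that $Y$ is bounded almost surely in $\mathbb R^k$, that is, there exists $\rho>0$ such that $\|Y\|_2<\rho$ almost surely. Let $v_l:=\Sigma_{l,l}/\rho^2$ for $l=1,\dots,k$, and write $S=S^{\mathbf u}(f)$. Let $N\ge1$ be an integer. Then, for all $t\ge0$, $$\mathbb P\left(S_{\mathbf u,N}-S\ge t\right)\le\exp\left(-\frac N{32}\left(\frac{t-\frac1{2N}(S+t-1)(S+1)}{1+S+t+|S+t-1|}\sum_{l=1}^kv_l\right)^2\right),$$ and, for all $t\ge\frac{(1-S)(1+S)}{2N-(1+S)}$, $$\mathbb P\left(S_{\mathbf u,N}-S\le-t\right)\le\exp\left(-\frac N{32}\left(\frac{t+\frac1{2N}(S-t-1)(S+1)}{1+S-t+|S-t-1|}\sum_{l=1}^kv_l\right)^2\right).$$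
   Context: For $\mathbf u\subset\{1,\dots,p\}$, $X_{\mathbf u}=(X_i,\ i\in\mathbf u)$ and $\sim\!\mathbf u$ is the complement of $\mathbf u$. $C_{\mathbf u}$ is the covariance matrix of $\mathbb E(Y\mid X_{\mathbf u})$, and $S^{\mathbf u}(f)=\mathrm{Tr}(C_{\mathbf u})/\mathrm{Tr}(\Sigma)$. $\|\cdot\|_2$ is the Euclidean norm. Set $Y^{\mathbf u}=f(X_{\mathbf u},X'_{\sim\mathbf u})$, where $X'_{\sim\mathbf u}$ is an independent copy of $X_{\sim\mathbf u}$, also independent of $X_{\mathbf u}$. Let $(Y_i,Y_i^{\mathbf u})_{1\le i\le N}$ be i.i.d. copies of the pair $(Y,Y^{\mathbf u})$, and let $Y_{i,l}$, $Y_{i,l}^{\mathbf u}$ be the $l$-th components of $Y_i$, $Y_i^{\mathbf u}$. The Pick and Freeze estimator is $$S_{\mathbf u,N}=\frac{\sum_{l=1}^k\left(\frac1N\sum_{i=1}^NY_{i,l}Y_{i,l}^{\mathbf u}-\left(\frac1N\sum_{i=1}^N\frac{Y_{i,l}+Y_{i,l}^{\mathbf u}}2\right)^2\right)}{\sum_{l=1}^k\left(\frac1N\sum_{i=1}^N\frac{Y_{i,l}^2+(Y_{i,l}^{\mathbf u})^2}2-\left(\frac1N\sum_{i=1}^N\frac{Y_{i,l}+Y_{i,l}^{\mathbf u}}2\right)^2\right)} .$$ *)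

(* Defs.v *)
From HB Require Import structures.
From mathcomp Require Import all_boot all_order all_algebra.
From mathcomp Require Import all_classical all_reals all_analysis.

Set Implicit Arguments.
Unset Strict Implicit.
Unset Printing Implicit Defensive.

Import Order.TTheory GRing.Theory Num.Theory.
Import numFieldNormedType.Exports.

Local Open Scope classical_set_scope.
Local Open Scope ring_scope.

Section product_space.
Context (I : Type) (d : I -> measure_display) (E : forall i, measurableType (d i)).

Definition cylinders : set (set (forall i, E i)) :=
  [set A | exists i, exists2 B, measurable B & A = (fun x => x i) @^-1` B].

(* The library only has products of two factors and of identical factors
   (tuples). *)
Definition prod_space := g_sigma_algebraType cylinders.

End product_space.

Section random_vectors.
Context (I : finType) (d : I -> measure_display)
  (E : forall i, measurableType (d i)) (T : Type).

Definition joint (X : forall i, T -> E i) : T -> prod_space E :=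
  fun w i => X i w.

Definition subproduct (u : {set I}) :=
  prod_space (fun i : {i : I | i \in u} => E (val i)).

Definition subvector (u : {set I}) (X : forall i, T -> E i) :
    T -> subproduct u :=
  fun w i => X (val i) w.

Definition freeze (u : {set I}) (X X' : forall i, T -> E i) : forall i, T -> E i :=
  fun i => if i \in u then X i else X' i.

End random_vectors.

Arguments subvector {I d E T} u X w i.
Arguments freeze {I d E T} u X X' i w.

Section laws.
Context (R : realType).

Definition same_law (d1 d2 d' : measure_display) (T1 : measurableType d1)
    (T2 : measurableType d2) (V : measurableType d')
    (P1 : probability T1 R) (X1 : T1 -> V)
    (P2 : probability T2 R) (X2 : T2 -> V) : Prop :=
  forall B : set V, measurable B -> P1 (X1 @^-1` B) = P2 (X2 @^-1` B).

Definition independent2 (d d1 d2 : measure_display) (T : measurableType d)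
    (V1 : measurableType d1) (V2 : measurableType d2) (P : probability T R)
    (X1 : T -> V1) (X2 : T -> V2) : Prop :=
  forall (A : set V1) (B : set V2), measurable A -> measurable B ->
    P (X1 @^-1` A `&` X2 @^-1` B) = (P (X1 @^-1` A) * P (X2 @^-1` B))%E.

Definition mutually_independent (d : measure_display) (T : measurableType d)
    (P : probability T R) (I : finType) (dE : I -> measure_display)
    (E : forall i, measurableType (dE i)) (X : forall i, T -> E i) : Prop :=
  forall (J : {set I}) (A : forall i, set (E i)),
    (forall i, i \in J -> measurable (A i)) ->
    P (\bigcap_(i in [set` J]) (X i @^-1` A i)) =
    (\prod_(i in J) P (X i @^-1` A i))%E.

(* Z is a version of E(Y | X). *)
Definition cond_expectation (d d' : measure_display) (T : measurableType d)
    (V : measurableType d') (P : probability T R) (X : T -> V)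
    (Y Z : T -> R) : Prop :=
  [/\ measurable_fun [set: g_sigma_algebra_preimageType X]
        (Z : g_sigma_algebra_preimageType X -> R),
      P.-integrable setT (EFin \o Z) &
      forall A, g_sigma_algebra_preimage X A ->
        (\int[P]_(w in A) (Z w)%:E = \int[P]_(w in A) (Y w)%:E)%E].

End laws.

(* Vectors of R^k are k-tuples, because these carry the product sigma-algebra
   in the library. *)
Section vectors.
Context (R : realType) (k : nat).

Definition norm2 (y : k.-tuple R) : R := Num.sqrt (\sum_(l < k) tnth y l ^+ 2).

Definition cond_expectation_vec (d d' : measure_display) (T : measurableType d)
    (V : measurableType d') (P : probability T R) (X : T -> V)
    (Y Z : T -> k.-tuple R) : Prop :=
  forall l : 'I_k,
    cond_expectation P X (fun w => tnth (Y w) l) (fun w => tnth (Z w) l).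

Definition cov_mx (d : measure_display) (T : measurableType d)
    (P : probability T R) (Y : T -> k.-tuple R) : 'M[R]_k :=
  \matrix_(l, m)
    fine (covariance P (fun w => tnth (Y w) l) (fun w => tnth (Y w) m)).

Definition posdef_mx (A : 'M[R]_k) : Prop :=
  A^T = A /\ forall x : 'rV[R]_k, x != 0 -> 0 < (x *m A *m x^T) 0 0.

(* When Z is a version of E(Y | X_u), this is the index S^u(f). *)
Definition sobol_index (d : measure_display) (T : measurableType d)
    (P : probability T R) (Y Z : T -> k.-tuple R) : R :=
  \tr (cov_mx P Z) / \tr (cov_mx P Y).

(* The i-th element of the sample is the pair (Y_i, Y_i^u). *)
Definition pick_freeze (N : nat) (s : 'I_N -> k.-tuple R * k.-tuple R) : R :=
  let y i l := tnth (s i).1 l in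
  let yu i l := tnth (s i).2 l in
  let mean l := N%:R^-1 * \sum_(i < N) (y i l + yu i l) / 2 in
  (\sum_(l < k) (N%:R^-1 * (\sum_(i < N) y i l * yu i l) - mean l ^+ 2)) /
  (\sum_(l < k) (N%:R^-1 * (\sum_(i < N) (y i l ^+ 2 + yu i l ^+ 2) / 2)
                 - mean l ^+ 2)).

End vectors.

(* Main.v *)
(** With h = (Y + Y^u)/2 and q = (Y - Y^u)/2, the estimator is (V - Q)/(V + Q),
    where V is the empirical variance of h and Q the empirical second moment
    of q.  So S_N >= a forces (1 - a) V - (1 + a) Q >= 0, and symmetrically for
    S_N <= a; moreover |S_N| <= 1, so only a in [-1, 1] matters, and there the
    two denominators of the theorem equal 2.  The mean of V and Q follows from
    E(Y_l Y^u_l) = E(E(Y_l | X_u)^2), which also holds because Y^u is Y with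
    its coordinates outside u resampled.  Changing one sample moves
    (1 - a) V - (1 + a) Q by at most 8 rho^2 / N, and the bounded differences
    method concludes, even with the weak constant cosh x <= exp (x^2 / 2). *)
Require Import Defs.
From HB Require Import structures.
From mathcomp Require Import all_boot all_order all_algebra.
From mathcomp Require Import all_classical all_reals all_analysis.
From mathcomp Require Import measurable_realfun.
From mathcomp Require Import ring lra.

Set Implicit Arguments.
Unset Strict Implicit.
Unset Printing Implicit Defensive.

Import Order.TTheory GRing.Theory Num.Theory.
Import numFieldNormedType.Exports.

Local Open Scope classical_set_scope.
Local Open Scope ring_scope.

(** * Bounded random variables and product spaces *)

(** The bounded differences method needs bounds at every sample point, whereas Y is bounded only
    almost surely and Z is an arbitrary version of the conditional expectation. Hence Y is replaced
    by 0 outside the ball of radius rho, Z is truncated, and almost sure equalities carry the result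
    back.

    The formula for E(Y_l Y^u_l) is obtained without any notion of conditional independence. Once
    X'_{~u} is fixed, Y^u is a function of X_u, so Y may be replaced by Z in the product. Then Y^u
    may be replaced by Z, because Z is also a version of E(Y^u | X_u).

    The terms in 1/(2N) of the theorem are the bias of V, whose mean carries a factor 1 - 1/N. With
    a = S + t or a = S - t and sigma the trace of Sigma, the numerator of the theorem times sigma
    is, up to sign, the mean of (1 - a) V - (1 + a) Q. The lower bound on t in the second inequality
    says that this mean has the sign required for a deviation inequality. *)

Section bounded_functions.
Context d (T : measurableType d) (R : realType) {P : probability T R}.
Implicit Types f g : T -> R.

Lemma bounded_integrable f M : measurable_fun setT f ->
  (forall x, `|f x| <= M) -> P.-integrable setT (EFin \o f).
Proof.
move=> mf fM; apply: measurable_bounded_integrable => //.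
  by rewrite (le_lt_trans (probability_le1 P measurableT))// ltry.
exists M; split; first exact: num_real.
by move=> x Mx y _ /=; exact: le_trans (fM y) (ltW Mx).
Qed.

Lemma Rintegral_constT (c : R) : \int[P]_x c = c.
Proof. by rewrite Rintegral_cst// [X in fine X](probability_setT P) mulr1. Qed.

Lemma Rintegral_sum (I : Type) (s : seq I) (f : I -> T -> R) :
  (forall i, P.-integrable setT (EFin \o f i)) ->
  \int[P]_x (\sum_(i <- s) f i x) = \sum_(i <- s) \int[P]_x f i x.
Proof.
move=> fi; have sumi r : P.-integrable setT (EFin \o fun x => \sum_(i <- r) f i x).
  rewrite (_ : _ \o _ = fun x => (\sum_(i <- r) (f i x)%:E)%E); last first.
    by apply/funext => x /=; rewrite sumEFin.
  by apply: integrable_sum => // i _; exact: fi.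
elim: s => [|i s IH].
  under eq_Rintegral do rewrite big_nil.
  by rewrite Rintegral_constT big_nil.
under eq_Rintegral do rewrite big_cons.
by rewrite RintegralD// ?IH ?big_cons//; exact: sumi.
Qed.

Lemma ae_eq_Rintegral f g : measurable_fun setT f -> measurable_fun setT g ->
  {ae P, forall x, f x = g x} -> \int[P]_x f x = \int[P]_x g x.
Proof.
move=> mf mg fg; rewrite /Rintegral; congr fine; apply: ae_eq_integral => //.
- exact/measurable_EFinP.
- exact/measurable_EFinP.
- by apply: filterS fg => x /= ->.
Qed.

Lemma ler_norm_Rintegral f M : measurable_fun setT f ->
  (forall x, `|f x| <= M) -> `|\int[P]_x f x| <= M.
Proof.
move=> mf fM; have fi := bounded_integrable mf fM.
apply: (le_trans (le_normr_Rintegral _ fi)) => //.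
rewrite -[leRHS]Rintegral_constT; apply: le_Rintegral => //.
  by apply: (bounded_integrable (M := M)) => [|x]; [exact: measurableT_comp|rewrite normr_id].
by apply: (bounded_integrable (M := `|M|)).
Qed.

Lemma EFin_Rintegral D f : measurable D -> P.-integrable D (EFin \o f) ->
  (\int[P]_(x in D) f x)%:E = (\int[P]_(x in D) (f x)%:E)%E.
Proof. by move=> mD fi; rewrite fineK//; exact: integrable_fin_num. Qed.

Lemma le_probability_ae (A B : set T) : measurable A -> measurable B ->
  {ae P, forall w, A w -> B w} -> (P A <= P B)%E.
Proof.
move=> mA mB [N [mN N0 AN]].
have AB : A `<=` B `|` N.
  move=> w Aw; have [Bw|nBw] := pselect (B w); [by left|right; apply: AN].
  by move=> /(_ Aw).
apply: (@le_trans _ _ (P (B `|` N))).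
  by apply: le_measure => //; rewrite inE//; exact: measurableU.
by apply: (le_trans (measureU2 _ _ _)) => //; rewrite [X in (_ + X)%E]N0 adde0.
Qed.

(** The variance of an almost surely bounded variable is computed on a bounded representative [x],
    for which all integrals in the expansion of the square are finite. It serves for the components
    of both [Y] and [Z]. *)
Lemma variance_ae_bounded (X x : T -> R) (M : R) : measurable_fun setT X ->
  measurable_fun setT x -> (forall w, `|x w| <= M) -> {ae P, forall w, X w = x w} ->
  fine (covariance P X X) = \int[P]_w (x w * x w) - (\int[P]_w x w) ^+ 2.
Proof.
move=> mX mx xM Xx; rewrite covariance.unlock !expectation.unlock.
have mE : \int[P]_w X w = \int[P]_w x w by exact: ae_eq_Rintegral.
rewrite -[fine (\int[P]_w (X w)%:E)%E]/(\int[P]_w X w) mE.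
set m := \int[P]_w x w.
rewrite -/(Rintegral P setT ((X \- cst m) * (X \- cst m))).
have ix := bounded_integrable mx xM.
have ixx : P.-integrable setT (EFin \o (fun w => x w * x w)).
  apply: (bounded_integrable (M := M * M)); first exact: measurable_funM.
  by move=> w; rewrite normrM ler_pM.
rewrite (@ae_eq_Rintegral _ (fun w => x w * x w - (2 * m * x w - m * m))); last 3 first.
- by apply: measurable_funM; exact: measurable_funB.
- by do ?[apply: measurable_funB => //|apply: measurable_funM => //].
- by apply: filterS Xx => w e; rewrite /= -e /cst/=; ring.
have imx : P.-integrable setT (EFin \o (fun w => 2 * m * x w)).
  exact: (integrableZl measurableT (2 * m) ix).
have icst : P.-integrable setT (EFin \o (fun _ : T => m * m)).
  by apply: (bounded_integrable (M := `|m * m|)).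
rewrite RintegralB//; last exact: (integrableB measurableT imx icst).
rewrite RintegralB// RintegralZl// Rintegral_constT -/m; ring.
Qed.

End bounded_functions.

Section pushforward_law.
Context (R : realType).

Lemma same_law_Rintegral d1 d2 d' (T1 : measurableType d1)
    (T2 : measurableType d2) (V : measurableType d')
    (P1 : probability T1 R) (P2 : probability T2 R)
    (X1 : T1 -> V) (X2 : T2 -> V) (phi : V -> R) (M : R) :
  measurable_fun setT X1 -> measurable_fun setT X2 -> measurable_fun setT phi ->
  (forall v, `|phi v| <= M) -> same_law P1 X1 P2 X2 ->
  \int[P1]_w phi (X1 w) = \int[P2]_w phi (X2 w).
Proof.
move=> mX1 mX2 mphi phiM law.
pose X1' : {mfun T1 >-> V} := HB.pack X1 (isMeasurableFun.Build _ _ _ _ X1 mX1).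
pose X2' : {mfun T2 >-> V} := HB.pack X2 (isMeasurableFun.Build _ _ _ _ X2 mX2).
have mEphi : measurable_fun setT (EFin \o phi) by exact/measurable_EFinP.
have i1 : P1.-integrable setT ((EFin \o phi) \o X1').
  by apply: (bounded_integrable (f := phi \o X1) (M := M)) => [|w]; [exact: measurableT_comp|exact: phiM].
have i2 : P2.-integrable setT ((EFin \o phi) \o X2').
  by apply: (bounded_integrable (f := phi \o X2) (M := M)) => [|w]; [exact: measurableT_comp|exact: phiM].
rewrite /Rintegral; congr fine.
have <- := integral_distribution (X := X1' : {RV P1 >-> V}) mEphi i1.
have <- := integral_distribution (X := X2' : {RV P2 >-> V}) mEphi i2.
by apply: eq_measure_integral => A mA _; exact: law.
Qed.

End pushforward_law.

(** * Fubini's theorem for independent variables *)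

Section section_integral.
Context (R : realType) d d1 d2 (T : measurableType d)
  (V1 : measurableType d1) (V2 : measurableType d2) {P : probability T R}.

Lemma measurable_section_Rintegral (X : T -> V2) (h : V1 * V2 -> R) (M : R) :
  measurable_fun setT X -> measurable_fun setT h -> (forall v, `|h v| <= M) ->
  measurable_fun setT (fun v => \int[P]_w h (v, X w)).
Proof.
move=> mX mh hM.
pose X' : {mfun T >-> V2} := HB.pack X (isMeasurableFun.Build _ _ _ _ X mX).
(* Measurability of a partial integral is part of Fubini's theorem for a product measure. Any
   probability on the first factor will do, here a Dirac mass. *)
pose m1 : probability V1 R := \d_point.
pose m2 : probability V2 R := distribution P X'.
have ih : (m1 \x m2)%E.-integrable setT (EFin \o h).
  exact: (bounded_integrable (P := (m1 \x m2)%E : probability (V1 * V2)%type R) mh hM).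
rewrite [X in measurable_fun _ X](_ : _ = fun v => \int[m2]_y h (v, y)); last first.
  apply/funext => v.
  apply: (same_law_Rintegral (X2 := id) (phi := fun y => h (v, y)) (M := M)) => //.
  exact: measurableT_comp mh (pair1_measurable v).
apply: measurableT_comp => //.
exact: (measurable_fubini_F (m1 := m1) (m2 := m2) ih).
Qed.

(** Independence makes the law of the pair the product of the two laws, by uniqueness of product
    measures; Fubini's theorem does the rest. Conditioning on an independent variable always takes
    this form below. *)
Lemma independent2_Rintegral (X1 : T -> V1) (X2 : T -> V2) (h : V1 * V2 -> R)
    (M : R) :
  measurable_fun setT X1 -> measurable_fun setT X2 -> independent2 P X1 X2 ->
  measurable_fun setT h -> (forall v, `|h v| <= M) ->
  \int[P]_w h (X1 w, X2 w) = \int[P]_w \int[P]_w' h (X1 w, X2 w').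
Proof.
move=> mX1 mX2 X12 mh hM.
pose X1' : {mfun T >-> V1} := HB.pack X1 (isMeasurableFun.Build _ _ _ _ X1 mX1).
pose X2' : {mfun T >-> V2} := HB.pack X2 (isMeasurableFun.Build _ _ _ _ X2 mX2).
pose m1 : probability V1 R := distribution P X1'.
pose m2 : probability V2 R := distribution P X2'.
have mX12 : measurable_fun setT (fun w => (X1 w, X2 w)) by exact: measurable_fun_pair.
have sectionE v : \int[P]_w h (v, X2 w) = \int[m2]_y h (v, y).
  apply: (same_law_Rintegral (X2 := id) (phi := fun y => h (v, y)) (M := M)) => //.
  exact: measurableT_comp mh (pair1_measurable v).
transitivity (\int[m1]_v \int[P]_w h (v, X2 w)); last first.
  symmetry; apply: (same_law_Rintegral (X2 := id)
    (phi := fun v => \int[P]_w h (v, X2 w)) (M := M)) => //.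
    exact: measurable_section_Rintegral.
  move=> v; apply: ler_norm_Rintegral => //.
  exact: measurableT_comp (measurableT_comp mh (pair1_measurable v)) mX2.
transitivity (\int[(m1 \x m2)%E : probability (V1 * V2)%type R]_z h z).
  apply: (same_law_Rintegral (X2 := id) (phi := h) (M := M)) => //.
  move=> A mA; apply/esym.
  pose X' : {mfun T >-> (V1 * V2)%type} :=
    HB.pack (fun w => (X1 w, X2 w)) (isMeasurableFun.Build _ _ _ _ _ mX12).
  exact: (@product_measure_unique _ _ _ _ _ m1 m2 (distribution P X')).
have ih : (m1 \x m2)%E.-integrable setT (EFin \o h).
  exact: (bounded_integrable (P := (m1 \x m2)%E : probability (V1 * V2)%type R) mh hM).
rewrite {1}/Rintegral -(integral12_prod_meas1 ih)/=; congr fine.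
apply: eq_integral => v _; rewrite sectionE EFin_Rintegral//.
apply: (bounded_integrable (M := M)) => //.
exact: measurableT_comp mh (pair1_measurable v).
Qed.

End section_integral.

(** * Boxes as a generating system of the product sigma-algebra *)

Section product_space.
Context (R : realType) (I : finType) (dE : I -> measure_display)
  (E : forall i, measurableType (dE i)).

Lemma measurable_coord i : measurable_fun setT (fun x : prod_space E => x i).
Proof.
move=> _ B mB; rewrite setTI; apply: sub_sigma_algebra.
by exists i, B.
Qed.

Lemma measurable_prod_spaceP d (T : measurableType d) (h : T -> prod_space E) :
  measurable_fun setT h <-> forall i, measurable_fun setT (fun w => h w i).
Proof.
split=> [mh i|mh]; first by have := measurableT_comp (@measurable_coord i) mh.
apply: (@measurability _ _ _ (prod_space E) setT h (@cylinders _ _ E)) => //.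
move=> _ [_ [i [B mB ->]] <-]; exact: mh.
Qed.

Definition box (A : forall i, set (E i)) : set (prod_space E) :=
  [set x | forall i, A i (x i)].

Lemma measurable_box A : (forall i, measurable (A i)) -> measurable (box A).
Proof.
move=> mA; rewrite (_ : box A = \bigcap_(i in setT) (fun x : prod_space E => x i) @^-1` A i); last first.
  by apply/seteqP; split=> x /= Ax i; [move=> _; exact: Ax|exact: (Ax i)].
apply: fin_bigcap_measurable => // i _.
rewrite -[X in measurable X]setTI; exact: measurable_coord.
Qed.

(** A cylinder is a box whose other sides are full. Boxes, unlike cylinders, are stable under
    intersection, which is what the uniqueness of measures asks of a generating system. *)
Lemma measurable_boxE : @measurable _ (prod_space E) =
  <<s [set B | exists2 A, forall i, measurable (A i) & B = box A] >>.
Proof.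
apply/seteqP; split.
  apply: smallest_sub; first exact: smallest_sigma_algebra.
  move=> _ [i [B mB ->]]; apply: sub_sigma_algebra.
  exists (eqtype.dfwith (fun j => @setT (E j)) B).
    by move=> j; case: eqtype.dfwithP.
  apply/seteqP; split=> x /=.
    by move=> Bx j; case: eqtype.dfwithP.
  by move=> /(_ i); rewrite dfwith_in.
apply: smallest_sub; first exact: sigma_algebra_measurable.
by move=> _ [A mA ->]; exact: measurable_box.
Qed.

Lemma box_measure_unique (m1 m2 : {measure set (prod_space E) -> \bar R}) :
  (m1 setT < +oo)%E ->
  (forall A, (forall i, measurable (A i)) -> m1 (box A) = m2 (box A)) ->
  forall B, measurable B -> m1 B = m2 B.
Proof.
move=> m1oo m12 B mB.
apply: (measure_unique _ (fun=> setT) measurable_boxE) => //.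
- move=> _ _ [A mA ->] [A' mA' ->]; exists (fun i => A i `&` A' i).
    by move=> i; exact: measurableI.
  apply/seteqP; split=> [x [Ax A'x] i|x AA'x]; first by split.
  by split=> i; have [] := AA'x i.
- move=> _; exists (fun=> setT) => //.
  by apply/seteqP; split.
- by rewrite bigcup_const.
- by move=> _ [A mA ->]; exact: m12.
Qed.

End product_space.
Arguments measurable_coord {I dE E}.

(** * Independent sequences and bounded differences *)

Section ord_cons.
Context (n : nat) (D : Type).

(** The identification of [D * D^n] with [D^(n+1)], on which the induction over the sample size
    runs. *)
Definition ord_cons (v : D) (s : 'I_n -> D) (i : 'I_n.+1) : D :=
  if unlift ord0 i is Some j then s j else v.

Lemma ord_cons0 v s : ord_cons v s ord0 = v.
Proof. by rewrite /ord_cons unlift_none. Qed.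

Lemma ord_cons_lift v s i : ord_cons v s (lift ord0 i) = s i.
Proof. by rewrite /ord_cons liftK. Qed.

Lemma ord_consE (s : 'I_n.+1 -> D) : ord_cons (s ord0) (fun i => s (lift ord0 i)) = s.
Proof. by apply/funext => i; rewrite /ord_cons; case: unliftP => [j ->|->]. Qed.

End ord_cons.

Section independent_sequence.
Context (R : realType) d d' (T : measurableType d) (V : measurableType d')
  (P : probability T R).

Definition power_space n := prod_space (fun _ : 'I_n => V).

Lemma measurable_ord_cons n :
  measurable_fun setT (fun x : V * power_space n => ord_cons x.1 x.2 : power_space n.+1).
Proof.
apply/measurable_prod_spaceP => i; rewrite /ord_cons.
case: unlift => [j|]; last exact: measurable_fst.
exact: measurableT_comp (measurable_coord (E := fun _ : 'I_n => V) j) measurable_snd.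
Qed.

Lemma mutually_independent_rest n (W : 'I_n.+1 -> T -> V) :
  mutually_independent P (E := fun=> V) W ->
  mutually_independent P (E := fun=> V) (fun i => W (lift ord0 i)).
Proof.
move=> indW J A mA.
have := indW (lift ord0 @: J) (ord_cons setT A).
rewrite big_imset/=; last by move=> i j _ _; exact: lift_inj.
under eq_bigr do rewrite ord_cons_lift.
move=> <-; last by move=> _ /imsetP[i iJ ->]; rewrite ord_cons_lift; exact: mA.
congr (P _); apply/seteqP; split=> w /= Ww.
  by move=> _ /imsetP[i iJ ->]; rewrite ord_cons_lift; exact: Ww.
by move=> i iJ; have := Ww (lift ord0 i); rewrite ord_cons_lift; apply; exact: imset_f.
Qed.

(** Mutual independence speaks of boxes only. For fixed [A], both sides are finite measures in [B]:
    the restriction of [P] to the event [W ord0] in [A], pushed forward by [rest], and a multiple of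
    the law of [rest]. They agree on boxes, hence everywhere. *)
Lemma independent2_rest n (W : 'I_n.+1 -> T -> V) :
  (forall i, measurable_fun setT (W i)) ->
  mutually_independent P (E := fun=> V) W ->
  independent2 P (W ord0) (fun w => (fun i => W (lift ord0 i) w) : power_space n).
Proof.
move=> mW indW A B mA mB.
set rest := fun w => _ : power_space n.
have mrest : measurable_fun setT rest.
  by apply/measurable_prod_spaceP => i; exact: mW.
have mWA : measurable (W ord0 @^-1` A).
  by rewrite -[X in measurable X]setTI; exact: mW.
have box_indep A' (B' : forall i : 'I_n, set V) : measurable A' ->
    (forall i, measurable (B' i)) ->
    P (W ord0 @^-1` A' `&` rest @^-1` box (E := fun=> V) B') =
    (P (W ord0 @^-1` A') * \prod_(i < n) P (W (lift ord0 i) @^-1` B' i))%E.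
  move=> mA' mB'; have := indW [set: 'I_n.+1]%SET (ord_cons A' B').
  rewrite big_mkcond/= big_ord_recl/= finset.in_setT ord_cons0.
  under eq_bigr do rewrite finset.in_setT ord_cons_lift.
  move=> <-; last first.
    by move=> i _; rewrite /ord_cons; case: unlift.
  congr (P _); apply/seteqP; split=> w /=.
    by move=> [w0 w1] i _; rewrite /ord_cons; case: unliftP => [j|] ->//; exact: w1.
  move=> Ww; split; first by have := Ww ord0; rewrite ord_cons0; apply; rewrite /= inE.
  by move=> i; have := Ww (lift ord0 i); rewrite ord_cons_lift; apply; rewrite /= inE.
have [m1 m1E] : exists m : {measure set (power_space n) -> \bar R},
    forall B', m B' = P (W ord0 @^-1` A `&` rest @^-1` B').
  unshelve eexists (pushforward (mrestr P mWA) rest : {measure set _ -> \bar R}) => //.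
  by move=> B'; rewrite /= /pushforward /mrestr setIC.
have PWA : P (W ord0 @^-1` A) = (fine (P (W ord0 @^-1` A)))%:E.
  by rewrite fineK// fin_num_measure.
have PWA0 : 0 <= fine (P (W ord0 @^-1` A)) by exact: fine_ge0.
have [m2 m2E] : exists m : {measure set (power_space n) -> \bar R},
    forall B', m B' = (P (W ord0 @^-1` A) * P (rest @^-1` B'))%E.
  unshelve eexists (mscale (NngNum PWA0) (pushforward P rest) : {measure set _ -> \bar R}) => //.
  by move=> B'; rewrite /= /mscale/= /pushforward -PWA.
rewrite -m1E -m2E; apply: (@box_measure_unique R _ _ (fun _ : 'I_n => V)) => //.
  by rewrite m1E preimage_setT setIT PWA ltry.
move=> B' mB'; rewrite m1E m2E box_indep//.
(* With the whole space in place of [A], the product over the remaining indices becomes the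
   probability that [rest] lies in the box. *)
have := box_indep setT B' measurableT mB'.
by rewrite preimage_setT setTI probability_setT mul1e => ->.
Qed.

End independent_sequence.
Arguments measurable_ord_cons {d' V}.

(** * Exponential inequalities and Hoeffding's lemma *)

Section exponential_bounds.
Context (R : realType).
Implicit Types x y c : R.

(** This is tanh x <= x: the difference of the two sides vanishes at 0 and has derivative y (exp y -
    exp (- y)), nonnegative for y >= 0. *)
Lemma sinh_le_mul_cosh x : 0 <= x ->
  expR x - expR (- x) <= x * (expR x + expR (- x)).
Proof.
move=> x0; pose k y := y * (expR y + expR (- y)) - (expR y - expR (- y)) : R.
pose k' y := y * (expR y - expR (- y)) : R.
have dk y : is_derive y (1:R) k (k' y).
  by apply: is_derive_eq; rewrite /k' /GRing.scale/=; ring.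
suff : k 0 <= k x by rewrite /k mul0r oppr0 subrr subr0 subr_ge0.
apply: (@ger0_derive1_ndecry _ k 0) => //.
- move=> y; rewrite in_itv/= andbT => y0; rewrite derive1E derive_val /k'.
  by rewrite mulr_ge0 ?(ltW y0)// subr_ge0 ler_expR; lra.
- by apply: continuous_subspaceT => y; exact/differentiable_continuous/derivable1_diffP.
Qed.

(** The product cosh y exp (- y^2 / 2) equals 1 at 0 and does not increase for y >= 0, its
    derivative being (sinh y - y cosh y) exp (- y^2 / 2). The function [k] is its opposite, to fit a
    criterion for nondecreasing functions. *)
Lemma cosh_le_exp_sqr x : (expR x + expR (- x)) / 2 <= expR (x ^+ 2 / 2).
Proof.
wlog x0 : x / 0 <= x.
  move=> H; have [/H//|/ltW x0] := leP 0 x.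
  by have := H (- x); rewrite opprK sqrrN oppr_ge0 addrC; apply.
pose k y := - ((expR y + expR (- y)) / 2 * expR (- (y ^+ 2 / 2))) : R.
pose k' y := ((y * (expR y + expR (- y)) - (expR y - expR (- y))) / 2 * expR (- (y ^+ 2 / 2))) : R.
have dk y : is_derive y (1:R) k (k' y).
  by apply: is_derive_eq; rewrite /k' /GRing.scale/=; field.
have : k 0 <= k x.
  apply: (@ger0_derive1_ndecry _ k 0) => //.
  - move=> y; rewrite in_itv/= andbT => y0; rewrite derive1E derive_val /k'.
    rewrite mulr_ge0 ?expR_ge0// divr_ge0// subr_ge0; exact/sinh_le_mul_cosh/ltW.
  - by apply: continuous_subspaceT => y; exact/differentiable_continuous/derivable1_diffP.
rewrite /k oppr0 expR0 expr0n/= mul0r oppr0 expR0 mulr1 lerN2.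
by rewrite [expR (- (x ^+ 2 / 2))]expRN ler_pdivrMr ?expR_gt0// -[1 + 1]/(2%:R) divff// mul1r.
Qed.

(** On [- c, c] the convex exponential lies below its chord; [y] is the average of [- c] and [c]
    with weight (c - y) / (2 c) on [- c]. For c = 0 the convention y / 0 = 0 makes the right-hand
    side 1. *)
Lemma expR_le_chord c y : `|y| <= c ->
  expR y <= (expR c + expR (- c)) / 2 + y / c * ((expR c - expR (- c)) / 2).
Proof.
move=> yc; have [c0|c0] := eqVneq c 0.
  have -> : y = 0 by apply/eqP; rewrite -normr_le0 (le_trans yc)// c0.
  by rewrite c0 oppr0 expR0 !mul0r addr0 -[1 + 1]/(2%:R) divff.
have cpos : 0 < c by rewrite lt_neqAle eq_sym c0 (le_trans _ yc).
move: yc; rewrite ler_norml => /andP[yc1 yc2].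
have /andP[t0 t1] : 0 <= (c - y) / (2 * c) <= 1.
  by rewrite divr_ge0 ?ler_pdivrMr//; lra.
pose t := Itv01 t0 t1.
have := convex_expR t (- c) c.
rewrite !convRE /= /unstable.onem.
have -> : (c - y) / (2 * c) * - c + (1 - (c - y) / (2 * c)) * c = y.
  by field.
move/le_trans; apply; rewrite le_eqVlt; apply/orP; left; apply/eqP.
by field.
Qed.

Context d (T : measurableType d) (P : probability T R).

(* The sharp constant c ^ 2 / 8 for a range of length c is not needed. *)
Lemma hoeffding_mgf (g : T -> R) c : measurable_fun setT g ->
  (forall w, `|g w - \int[P]_w' g w'| <= c) ->
  \int[P]_w expR (g w) <= expR (\int[P]_w g w + c ^+ 2 / 2).
Proof.
set m := \int[P]_w g w => mg gc.
have gM (x : T) : `|g x| <= c + `|m|.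
  by rewrite -(subrK m (g x)) (le_trans (ler_normD _ _))// lerD2r.
have ig := bounded_integrable (P := P) mg gM.
pose C := (expR c + expR (- c)) / 2; pose S := (expR c - expR (- c)) / 2.
(* A bound affine in [g w]: upon integration the terms with [S] cancel, since [m] is the mean of
   [g], and only [expR m] times cosh c remains. *)
have chord w : expR (g w) <= expR m * (C - m / c * S) + expR m / c * S * g w.
  rewrite -[X in expR X](subrK m) addrC expRD.
  have -> : expR m * (C - m / c * S) + expR m / c * S * g w =
     expR m * (C + (g w - m) / c * S) by ring.
  by rewrite ler_wpM2l ?expR_ge0// expR_le_chord.
have iaff : P.-integrable setT (EFin \o (fun w => expR m / c * S * g w)).
  apply: (bounded_integrable (M := `|expR m / c * S| * (c + `|m|))).
    by apply: measurable_funM => //; exact: measurable_cst.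
  by move=> x; rewrite normrM ler_wpM2l.
have icst : P.-integrable setT (EFin \o (fun w : T => expR m * (C - m / c * S))).
  by apply: bounded_integrable => //; exact: measurable_cst.
apply: (@le_trans _ _ (\int[P]_w (expR m * (C - m / c * S) + expR m / c * S * g w))).
  apply: le_Rintegral => //.
  - apply: (bounded_integrable (M := expR (c + `|m|))).
      exact: measurableT_comp.
    move=> x /=; rewrite ger0_norm ?expR_ge0// ler_expR.
    by rewrite (le_trans (ler_norm _)).
  - exact: (integrableD measurableT icst iaff).
rewrite RintegralD// Rintegral_constT RintegralZl// -/m expRD.
have -> : expR m * (C - m / c * S) + expR m / c * S * m = expR m * C by ring.
by rewrite ler_wpM2l ?expR_ge0// cosh_le_exp_sqr.
Qed.

End exponential_bounds.

(** * The bounded differences inequality *)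

Section bounded_differences.
Context (R : realType) d d' (T : measurableType d) (V : measurableType d')
  (P : probability T R).

(* By independence the first variable can be frozen: induction controls the
   remaining ones, and the resulting partial mean G varies by at most c. *)
Lemma bounded_differences_mgf n (W : 'I_n -> T -> V) (F : power_space V n -> R)
    (M c : R) :
  (forall i, measurable_fun setT (W i)) ->
  mutually_independent P (E := fun=> V) W ->
  measurable_fun setT F -> (forall s, `|F s| <= M) ->
  (forall i s s', (forall j, j != i -> s j = s' j) -> `|F s - F s'| <= c) ->
  \int[P]_w expR (F (W ^~ w)) <=
  expR (\int[P]_w F (W ^~ w) + n%:R * (c ^+ 2 / 2)).
Proof.
elim: n W F => [|n IH] W F mW indW mF FM Fc.
  have FE w : F (W ^~ w) = F (fun i => False_rect _ (notF (ltn_ord i))).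
    by congr F; apply/funext => -[].
  under eq_Rintegral do rewrite FE.
  under [X in expR (X + _)]eq_Rintegral do rewrite FE.
  by rewrite !Rintegral_constT mul0r addr0.
pose rest w : power_space V n := fun i => W (lift ord0 i) w.
have mrest : measurable_fun setT rest by apply/measurable_prod_spaceP => i; exact: mW.
pose H (x : V * power_space V n) := F (ord_cons x.1 x.2).
have mH : measurable_fun setT H by exact: measurableT_comp mF (measurable_ord_cons n).
have HM x : `|H x| <= M by exact: FM.
have HE w : F (W ^~ w) = H (W ord0 w, rest w) by rewrite /H /= /rest (ord_consE (W ^~ w)).
have ind := independent2_rest mW indW.
have mHv v : measurable_fun setT (fun s => H (v, s)).
  exact: measurableT_comp mH (pair1_measurable v).
have mHr v : measurable_fun setT (fun w => H (v, rest w)).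
  exact: measurableT_comp (mHv v) mrest.
pose G v := \int[P]_w H (v, rest w).
have mG : measurable_fun setT G := measurable_section_Rintegral mrest mH HM.
have GM v : `|G v| <= M by exact: ler_norm_Rintegral.
have HW : \int[P]_w F (W ^~ w) = \int[P]_w G (W ord0 w).
  under eq_Rintegral do rewrite HE.
  exact: (independent2_Rintegral (mW ord0) mrest ind mH HM).
have eHM x : `|(expR \o H) x| <= expR M.
  by rewrite /= ger0_norm ?expR_ge0// ler_expR (le_trans (ler_norm _)).
have meH : measurable_fun setT (expR \o H) by exact: measurableT_comp.
have -> : \int[P]_w expR (F (W ^~ w)) =
    \int[P]_w \int[P]_w' expR (H (W ord0 w, rest w')).
  under eq_Rintegral do rewrite HE.
  exact: (independent2_Rintegral (mW ord0) mrest ind meH eHM).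
have mGW : measurable_fun setT (fun w => G (W ord0 w)) := measurableT_comp mG (mW _).
have GWM w : `|G (W ord0 w)| <= M by [].
have iGW := bounded_integrable (P := P) mGW GWM.
have ieGW : P.-integrable setT (EFin \o fun w => expR (G (W ord0 w))).
  apply: (bounded_integrable (M := expR M)); first exact: measurableT_comp.
  by move=> w; rewrite ger0_norm ?expR_ge0// ler_expR (le_trans (ler_norm _)).
have Gdiff v v' : `|G v - G v'| <= c.
  have iH u := bounded_integrable (P := P) (mHr u) (fun w => HM (u, rest w)).
  rewrite /G -(RintegralB _ (iH v) (iH v'))//.
  apply: ler_norm_Rintegral; first exact: measurable_funB.
  move=> w; apply: (Fc ord0) => j; rewrite /ord_cons/=.
  by case: unliftP => [i|] -> //; rewrite eqxx.
apply: (@le_trans _ _ (\int[P]_w (expR (n%:R * (c ^+ 2 / 2)) * expR (G (W ord0 w))))).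
  apply: le_Rintegral => //.
  - apply: (bounded_integrable (M := expR M)).
      exact: measurableT_comp (measurable_section_Rintegral mrest meH eHM) (mW _).
    move=> w; apply: ler_norm_Rintegral => [|w'].
      exact: measurableT_comp (mHr _).
    exact: eHM.
  - apply: (bounded_integrable (M := expR (n%:R * (c ^+ 2 / 2)) * expR M)).
      by apply: measurable_funM; [exact: measurable_cst|exact: measurableT_comp].
    move=> w; rewrite ger0_norm ?mulr_ge0 ?expR_ge0// ler_wpM2l ?expR_ge0//.
    by rewrite ler_expR (le_trans (ler_norm _)).
  - move=> w _; rewrite -expRD addrC.
    apply: (IH (fun i => W (lift ord0 i)) (fun s => H (W ord0 w, s))) => //.
      exact: mutually_independent_rest.
    move=> i s s' ss'; apply: (Fc (lift ord0 i)) => j; rewrite /ord_cons/=.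
    case: unliftP => [k|] -> //= ki; apply: ss'.
    by apply: contraNneq ki => ->.
rewrite RintegralZl// HW -[n.+1%:R]natr1 mulrDl mul1r addrCA [leRHS]expRD ler_wpM2l ?expR_ge0//.
(* Two values of [G] differ by at most [c], hence so do a value and the mean: the value at [w] is
   written as the integral of a constant. *)
apply: hoeffding_mgf => // w.
have icst : P.-integrable setT (EFin \o fun=> G (W ord0 w)).
  by apply: (bounded_integrable (M := M)) => //; exact: measurable_cst.
rewrite -[X in X - _](Rintegral_constT (P := P)) -RintegralB//.
apply: ler_norm_Rintegral => //.
by apply: measurable_funB => //; exact: measurable_cst.
Qed.

Lemma bounded_differences_tail n (W : 'I_n -> T -> V) (F : power_space V n -> R)
    (M c tau : R) : (0 < n)%N -> 0 < c -> 0 <= tau ->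
  (forall i, measurable_fun setT (W i)) ->
  mutually_independent P (E := fun=> V) W ->
  measurable_fun setT F -> (forall s, `|F s| <= M) ->
  (forall i s s', (forall j, j != i -> s j = s' j) -> `|F s - F s'| <= c) ->
  (P [set w | (\int[P]_w F (W ^~ w) + tau <= F (W ^~ w))%R] <=
   (expR (- (tau ^+ 2 / (2 * n%:R * c ^+ 2))))%:E)%E.
Proof.
move=> n0 c0 tau_ge0 mW indW mF FM Fc.
set m := \int[P]_w _.
have mWP : measurable_fun setT (fun w => W ^~ w : power_space V n).
  exact/measurable_prod_spaceP.
have mFW := measurableT_comp mF mWP.
(* Chernoff's inequality wants r > 0; for tau = 0 the bound to prove is 1. *)
move: tau_ge0; rewrite le_eqVlt => /predU1P[<-|tau0].
  rewrite expr0n mul0r oppr0 expR0 probability_le1//.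
  rewrite -[X in measurable X]setTI; apply: measurable_fun_le => //.
pose X : {RV P >-> R} := HB.pack (fun w => F (W ^~ w)) (isMeasurableFun.Build _ _ _ _ _ mFW).
(* The minimiser of n r^2 c^2 / 2 - r tau. *)
pose r := tau / (n%:R * c ^+ 2).
have nR0 : 0 < n%:R :> R by rewrite ltr0n.
have r0 : 0 < r by rewrite divr_gt0// mulr_gt0// exprn_gt0.
have rF s : `|r * F s| <= r * M by rewrite normrM gtr0_norm// ler_pM2l.
apply: (le_trans (chernoff X (m + tau) r0)).
have -> : mmt_gen_fun P X r = (\int[P]_w expR (r * F (W ^~ w)))%:E.
  rewrite /mmt_gen_fun expectation.unlock EFin_Rintegral//.
    by apply: eq_integral => w _ /=; rewrite mulrC.
  apply: (bounded_integrable (M := expR (r * M))).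
    by apply: measurableT_comp => //; apply: measurable_funM.
  by move=> w; rewrite ger0_norm ?expR_ge0// ler_expR (le_trans (ler_norm _)).
have := @bounded_differences_mgf n W (fun s => r * F s) (r * M) (r * c) mW indW.
rewrite RintegralZl//; last exact: bounded_integrable mFW (fun w => FM _).
rewrite -/m => mgf; rewrite -EFinM lee_fin.
apply: (@le_trans _ _ (expR (r * m + n%:R * ((r * c) ^+ 2 / 2)) * expR (- (r * (m + tau))))).
  rewrite ler_wpM2r ?expR_ge0// mgf//.
    by apply: measurable_funM => //; exact: measurable_cst.
  move=> i s s' ss'; rewrite -mulrBr normrM gtr0_norm// ler_pM2l//.
  exact: Fc ss'.
rewrite -expRD ler_expR le_eqVlt; apply/orP; left; apply/eqP.
by rewrite /r; field; rewrite !gt_eqF.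
Qed.

End bounded_differences.

(** * Conditional expectations of bounded variables *)

Section conditional_expectation.
Context (R : realType) d dV (T : measurableType d) (V : measurableType dV)
  (P : probability T R) (X : T -> V) (mX : measurable_fun setT X).

Notation sigma_X := (g_sigma_algebra_preimageType X).

Lemma measurable_of_preimage A : g_sigma_algebra_preimage X A -> measurable A.
Proof. by move=> [B mB <-]; exact: mX. Qed.

Lemma measurable_fun_of_preimage dU (U : measurableType dU) (g : sigma_X -> U) :
  measurable_fun setT g -> measurable_fun [set: T] (g : T -> U).
Proof. by move=> mg _ B mB; apply: measurable_of_preimage; exact: mg. Qed.

Lemma measurable_fun_preimageType : measurable_fun setT (X : sigma_X -> V).
Proof. by move=> _ B mB; exists B. Qed.

(** The sum counts the integers from 1 to n that are at most x, so it is the floor of x. Applied to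
    n times a function with values in [0, 1], it yields an approximation by an average of
    indicators. *)
Lemma sum_indicators_bounds n (x : R) : 0 <= x -> x <= n%:R ->
  x - 1 <= \sum_(k < n) (k.+1%:R <= x)%R%:R <= x.
Proof.
elim: n => [|n IH] x0 xn.
  by rewrite big_ord0 x0 andbT lerBlDr add0r (le_trans xn).
rewrite big_ord_recr/=; have [nx|xn'] := leP x n%:R.
  have -> : (n.+1%:R <= x)%R = false.
    by apply/negbTE; rewrite -ltNge (le_lt_trans nx)// ltr_nat.
  by rewrite addr0 IH.
have -> : \sum_(i < n) (i.+1%:R <= x)%R%:R = n%:R :> R.
  under eq_bigr => i _.
    have -> : (i.+1%:R <= x)%R by rewrite (le_trans _ (ltW xn'))// ler_nat.
    over.
  by rewrite sumr_const card_ord.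
have [nx|nx] := leP n.+1%:R x; rewrite ?mulr1n ?mulr0n.
  have -> : x = n.+1%:R by apply: le_anti; rewrite xn nx.
  by rewrite natr1 lexx lerBlDr lerDl ler01.
by rewrite addr0 (ltW xn') andbT; move: nx; rewrite -natr1; lra.
Qed.

(** The event Z > M belongs to sigma(X), so Z and Y have the same integral over it. There Z - M is
    positive with integral at most 0, which forces the event to be null. *)
Lemma cond_expectation_le (Y Z : T -> R) (M : R) : measurable_fun setT Y ->
  (forall w, Y w <= M) -> P.-integrable setT (EFin \o Y) ->
  cond_expectation P X Y Z -> {ae P, forall w, Z w <= M}.
Proof.
move=> mY YM iY [mZ iZ ZY].
have mZT := measurable_fun_of_preimage mZ.
pose A := [set w | M < Z w].
have sA : g_sigma_algebra_preimage X A.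
  rewrite (_ : A = ~` [set w : sigma_X | Z w <= M]); last first.
    by apply/seteqP; split=> w; rewrite /A/= ltNge => /negP.
  suff : measurable (~` [set w : sigma_X | Z w <= M]) by [].
  apply: measurableC; rewrite -[X in measurable X]setTI.
  exact: measurable_fun_le.
have mA := measurable_of_preimage sA.
have iM : P.-integrable A (EFin \o cst M).
  by apply: (integrableS measurableT) => //; apply: (bounded_integrable (M := `|M|)).
have iZA : P.-integrable A (EFin \o Z) := integrableS measurableT mA (@subsetT _ _) iZ.
have iYA : P.-integrable A (EFin \o Y) := integrableS measurableT mA (@subsetT _ _) iY.
have ZA0 : \int[P]_(w in A) (Z w - M) <= 0.
  rewrite RintegralB// {1}/Rintegral ZY// -/(Rintegral P A Y) subr_le0.
  exact: le_Rintegral.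
have ZM0 : (\int[P]_(w in A) `|(Z w - M)%:E| = 0)%E.
  rewrite (@eq_integral _ _ _ P A (fun w => (Z w - M)%:E)); last first.
    by move=> w; rewrite inE /A/= => Mw; rewrite ger0_norm// subr_ge0 ltW.
  rewrite -EFin_Rintegral//; last exact: (integrableB mA iZA iM).
  congr EFin; apply/le_anti; rewrite ZA0 Rintegral_ge0// => w /= Mw.
  by rewrite subr_ge0 ltW.
have mZM : measurable_fun A (fun w => (Z w - M)%:E).
  apply: measurable_funTS; apply/measurable_EFinP.
  exact: measurable_funB.
have [+ _] := ae_eq_integral_abs P mA mZM; move=> /(_ ZM0); apply: filterS => w /=.
rewrite leNgt => + ; apply/contraPN => Mw /(_ Mw) [] /eqP.
by rewrite subr_eq0 gt_eqF.
Qed.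


(** The upper bound on [Z] comes from [cond_expectation_le] for [Y], the lower one from the same
    lemma for [- Y]. Truncation to [- M, M] keeps sigma(X)-measurability and alters [Z] on a null
    set only. *)
Lemma cond_expectation_clamp (Y Z : T -> R) (M : R) : measurable_fun setT Y ->
  0 <= M -> (forall w, `|Y w| <= M) -> cond_expectation P X Y Z ->
  exists Z', [/\ cond_expectation P X Y Z', forall w, `|Z' w| <= M &
    {ae P, forall w, Z' w = Z w}].
Proof.
move=> mY M0 YM YZ; have [mZ iZ ZY] := YZ.
have iY := bounded_integrable (P := P) mY YM.
have YM' w : Y w <= M by rewrite (le_trans (ler_norm _)).
have ZM := cond_expectation_le mY YM' iY YZ.
have NYM w : - Y w <= M by rewrite (le_trans (ler_norm _))// normrN.
have NZM : {ae P, forall w, - Z w <= M}.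
  have mNY : measurable_fun setT (fun w => - Y w) by exact: measurableT_comp.
  have bNY w : `|- Y w| <= M by rewrite normrN.
  apply: (cond_expectation_le mNY NYM (bounded_integrable mNY bNY)); split.
  - by apply: (@measurableT_comp _ _ _ sigma_X _ _ (@GRing.opp R) setT Z).
  - rewrite (_ : _ \o _ = (fun w => - (Z w)%:E)%E) //.
    exact: integrableN.
  - move=> A sA; have mA := measurable_of_preimage sA.
    under eq_integral do rewrite EFinN.
    under [RHS]eq_integral do rewrite EFinN.
    rewrite !integralN/= ?ZY//.
    + by apply: integrable_add_def => //; exact: (integrableS measurableT mA _ iY).
    + by apply: integrable_add_def => //; exact: (integrableS measurableT mA _ iZ).
pose Z' w := Num.max (- M) (Num.min M (Z w)).
have Z'Z : {ae P, forall w, Z' w = Z w}.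
  apply: filterS2 ZM NZM => w ZM NZM; rewrite /Z' min_r// max_r// lerNl//.
have mZ' : measurable_fun [set: sigma_X] (Z' : sigma_X -> R).
  by apply: measurable_maxr => //; exact: measurable_minr.
have Z'M w : `|Z' w| <= M.
  by rewrite ler_norml /Z' le_max lexx/= ge_max ge_min lexx/= andbT; lra.
have mZ'T := measurable_fun_of_preimage mZ'.
exists Z'; split=> //; split=> //; first exact: bounded_integrable mZ'T Z'M.
move=> A sA; have mA := measurable_of_preimage sA.
rewrite -ZY//; apply: ae_eq_integral => //.
- by apply: measurable_funTS; exact/measurable_EFinP.
- by apply: measurable_funTS; exact/measurable_EFinP/measurable_fun_of_preimage.
- by apply: filterS Z'Z => w /= -> .
Qed.

Variables (Y Z : T -> R) (M : R).
Hypotheses (mY : measurable_fun setT Y) (YM : forall w, `|Y w| <= M)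
  (ZM : forall w, `|Z w| <= M) (YZ : cond_expectation P X Y Z).

Let mZ : measurable_fun setT Z.
Proof. by have [mZ _ _] := YZ; exact: measurable_fun_of_preimage. Qed.

Lemma cond_expectation_indicator (b : T -> bool) :
  g_sigma_algebra_preimage X [set w | b w] ->
  \int[P]_w ((Y w - Z w) * (b w)%:R) = 0.
Proof.
move=> sb; have mb := measurable_of_preimage sb.
have [_ _ ZY] := YZ.
rewrite (_ : \int[P]_w ((Y w - Z w) * (b w)%:R) = \int[P]_(w in [set w | b w]) (Y w - Z w)); last first.
  rewrite [RHS]Rintegral_mkcond; apply: eq_Rintegral => w _.
  rewrite patchE mem_setE (_ : (w \in b) = b w)//.
  by case: (b w); rewrite ?mulr1 ?mulr0.
have iYA := integrableS measurableT mb (@subsetT _ _) (bounded_integrable (P := P) mY YM).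
have iZA := integrableS measurableT mb (@subsetT _ _) (bounded_integrable (P := P) mZ ZM).
by rewrite RintegralB// [X in _ - X]/Rintegral ZY// subrr.
Qed.

(* It suffices to treat [g] with values in [0, 1], which is uniformly within
   [1 / n] of an average of [n] indicators of events of [sigma(X)]. *)
Lemma cond_expectation_mul (g : T -> R) (K : R) :
  measurable_fun [set: sigma_X] (g : sigma_X -> R) -> (forall w, `|g w| <= K) ->
  \int[P]_w (Y w * g w) = \int[P]_w (Z w * g w).
Proof.
move=> sg gK; have mg := measurable_fun_of_preimage sg.
(* Adding 1 keeps 2 K' nonzero in the rescaling of [g] even when K = 0. *)
pose K' := K + 1.
have K0 : 0 <= K := le_trans (normr_ge0 _) (gK point).
have K'0 : 0 < K' by rewrite ltr_wpDl.
pose D w := Y w - Z w.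
have mD : measurable_fun setT D by exact: measurable_funB.
have DM w : `|D w| <= M + M by rewrite (le_trans (ler_normB _ _))// lerD.
pose h w : R := (g w + K') / (2 * K').
have gbnd w : - K <= g w <= K by rewrite -ler_norml.
have h01 w : 0 <= h w <= 1.
  have := gbnd w; rewrite /h /K' => /andP[? ?].
  by rewrite divr_ge0 ?ler_pdivrMr; lra.
have sh : measurable_fun [set: sigma_X] (h : sigma_X -> R).
  by apply: measurable_funM => //; exact: measurable_funD.
have mh := measurable_fun_of_preimage sh.
have bounded_mul (f : T -> R) L : measurable_fun setT f -> (forall w, `|f w| <= L) ->
    P.-integrable setT (EFin \o (fun w => D w * f w)).
  move=> mf fL; apply: (bounded_integrable (M := (M + M) * L)).
    exact: measurable_funM.
  by move=> w; rewrite normrM ler_pM.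
have hL w : `|h w| <= 1 by rewrite ger0_norm; have /andP[] := h01 w.
have small n : (0 < n)%N -> `|\int[P]_w (D w * h w)| <= (M + M) / n%:R.
  move=> n0; have nR0 : 0 < n%:R :> R by rewrite ltr0n.
  pose b (k : 'I_n) w := (k.+1%:R <= n%:R * h w)%R.
  have sb k : g_sigma_algebra_preimage X [set w | b k w].
    suff : measurable [set w : sigma_X | b k w] by [].
    rewrite -[X in measurable X]setTI; apply: measurable_fun_le => //.
    by apply: measurable_funM.
  have mb k : measurable_fun setT (fun w => (b k w)%:R : R).
    rewrite (_ : (fun w => _) = \1_[set w | b k w]).
      exact: measurable_indic (measurable_of_preimage (sb k)).
    by apply/funext => w; rewrite indicE mem_setE.
  have b1 k w : `|(b k w)%:R : R| <= 1 by case: (b k w); rewrite ?normr1// normr0.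
  (* Here [s] is the floor of n h divided by n; its product with [D] has integral 0 by linearity. *)
  pose s w : R := n%:R^-1 * \sum_(k < n) (b k w)%:R.
  have Ds0 : \int[P]_w (D w * s w) = 0.
    rewrite (_ : (fun w => _) = fun w => n%:R^-1 * \sum_(k < n) D w * (b k w)%:R).
      rewrite RintegralZl//.
        rewrite Rintegral_sum; last by move=> k; exact: bounded_mul (mb k) (b1 k).
        by rewrite big1 ?mulr0// => k _; exact: cond_expectation_indicator.
      rewrite (_ : _ \o _ = fun w => (\sum_(k < n) (D w * (b k w)%:R)%:E)%E); last first.
        by apply/funext => w /=; rewrite sumEFin.
      by apply: integrable_sum => // k _; exact: bounded_mul (mb k) (b1 k).
    by apply/funext => w; rewrite /s mulrCA mulr_sumr.
  have ms : measurable_fun setT s.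
    by apply: measurable_funM => //; exact: measurable_sum.
  have hs w : `|h w - s w| <= n%:R^-1.
    have /andP[h0 h1] := h01 w.
    have := @sum_indicators_bounds n (n%:R * h w).
    rewrite mulr_ge0// ger_pMr// => /(_ isT h1) /andP[l1 l2].
    rewrite /s -[h w](mulKf (lt0r_neq0 nR0)) -mulrBr normrM.
    rewrite [`|n%:R^-1|]ger0_norm ?invr_ge0 ?(ltW nR0)//.
    rewrite -[leRHS]mulr1 ler_wpM2l ?invr_ge0 ?(ltW nR0)//.
    by rewrite ger0_norm; lra.
  have sL w : `|s w| <= n%:R^-1 + 1.
    rewrite -[s w](subrK (h w)) (le_trans (ler_normD _ _))// lerD// distrC.
    exact: hs.
  rewrite -[X in `|X|]subr0 -Ds0 -RintegralB//; [|exact: bounded_mul mh hL|exact: bounded_mul ms sL].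
  apply: ler_norm_Rintegral => [|w].
    by apply: measurable_funB; exact: measurable_funM.
  by rewrite -mulrBr normrM ler_pM.
have Dh0 : \int[P]_w (D w * h w) = 0.
  apply/eqP; rewrite -normr_eq0 eq_le normr_ge0 andbT leNgt; apply/negP => I0.
  set I := `|_| in I0 small.
  have M0 : 0 <= M + M := le_trans (normr_ge0 _) (DM point).
  have := archi_boundP (divr_ge0 M0 (ltW I0)); set n := Num.bound _ => nb.
  have n0 : (0 < n)%N by rewrite -(ltr_nat R) (le_lt_trans _ nb)// divr_ge0// ltW.
  have := small n n0; rewrite leNgt => /negP; apply.
  by rewrite ltr_pdivrMr ?ltr0n// mulrC -ltr_pdivrMr.
have D0 : \int[P]_w D w = 0.
  transitivity (\int[P]_w ((Y w - Z w) * (xpredT w)%:R)).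
    by apply: eq_Rintegral => w _; rewrite mulr1.
  apply: cond_expectation_indicator; exists setT => //.
  by rewrite setTI preimage_setT; apply/seteqP; split.
apply/eqP; rewrite -subr_eq0 -RintegralB//; last 2 first.
- by apply: (bounded_integrable (M := M * K)) => [|w]; [exact: measurable_funM|rewrite normrM ler_pM].
- by apply: (bounded_integrable (M := M * K)) => [|w]; [exact: measurable_funM|rewrite normrM ler_pM].
(* Undoing the rescaling: g = 2 K' h - K', and both [D h] and [D] have integral 0. *)
rewrite (_ : (fun w => _) = fun w => 2 * K' * (D w * h w) - K' * D w); last first.
  apply/funext => w; rewrite /D /h; field.
  by rewrite gt_eqF.
have iD := bounded_integrable (P := P) mD DM.
have iDh := bounded_mul h _ mh hL.
rewrite RintegralB//; [|exact: (integrableZl measurableT (2 * K') iDh)|exact: (integrableZl measurableT K' iD)].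
by rewrite !RintegralZl// Dh0 D0 !mulr0 subrr.
Qed.

End conditional_expectation.

(** * Freezing coordinates *)

Section freezing.
Context (R : realType) (I : finType) (dE : I -> measure_display)
  (E : forall i, measurableType (dE i)) d (T : measurableType d)
  (P : probability T R) (u : {set I}).

Definition restrict_to (v : {set I}) (x : prod_space E) : subproduct E v :=
  fun i => x (val i).
Arguments restrict_to : clear implicits.

Lemma measurable_restrict_to v : measurable_fun setT (restrict_to v).
Proof.
apply/measurable_prod_spaceP => i.
exact: (measurable_coord (E := E)).
Qed.

(** Since [b] is indexed by the subtype of [v], a proof of membership is needed to evaluate it;
    matching on [idP] provides one. *)
Definition overwrite [v : {set I}] (b : subproduct E v) (x : prod_space E) :
    prod_space E :=
  fun i => if @idP (i \in v) is ReflectT iv then b (exist _ i iv) else x i.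

Lemma overwrite_in (v : {set I}) (b : subproduct E v) x (i : {i : I | i \in v}) : overwrite b x (val i) = b i.
Proof.
case: i => i iv /=; rewrite /overwrite; case: {-}_ / idP => // iv'.
by congr (b (exist _ _ _)); exact: bool_irrelevance.
Qed.

Lemma overwrite_out (v : {set I}) (b : subproduct E v) x i : i \notin v -> overwrite b x i = x i.
Proof. by rewrite /overwrite; case: {-}_ / idP => // iv /negP. Qed.

(** The source [S] is left general so that it may carry the sigma-algebra of X_u. With [v] the
    complement of u, the coordinates of X that survive are then the measurable ones. *)
Lemma measurable_overwrite dS (S : measurableType dS) (v : {set I}) (b : S -> subproduct E v)
    (x : S -> prod_space E) : measurable_fun setT b ->
  (forall i, i \notin v -> measurable_fun setT (fun s => x s i)) ->
  measurable_fun setT (fun s => overwrite (b s) (x s)).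
Proof.
move=> mb mx; apply/measurable_prod_spaceP => i.
have [iv|niv] := boolP (i \in v).
  under eq_fun do rewrite (overwrite_in _ _ (exist _ i iv)).
  by move/measurable_prod_spaceP : mb => /(_ (exist _ i iv)).
under eq_fun do rewrite overwrite_out//.
exact: mx.
Qed.

Variables (X X' : forall i, T -> E i).
Hypotheses (mX : forall i, measurable_fun setT (X i))
  (mX' : forall i, measurable_fun setT (X' i))
  (X_indep : mutually_independent P X)
  (X'_copy : same_law P (subvector (~: u) X') P (subvector (~: u) X))
  (X'_indep : independent2 P (joint X) (subvector (~: u) X')).

Lemma measurable_joint : measurable_fun setT (joint X).
Proof. exact/measurable_prod_spaceP. Qed.

Lemma freezeE w : joint (freeze u X X') w = overwrite (subvector (~: u) X' w) (joint X w).
Proof.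
apply/functional_extensionality_dep => i; rewrite /joint /freeze.
have [iu|niu] := boolP (i \in u).
  by rewrite overwrite_out// inE iu.
have iu' : i \in ~: u by rewrite inE.
by rewrite (overwrite_in _ _ (exist _ i iu')).
Qed.

Lemma measurable_joint_freeze : measurable_fun setT (joint (freeze u X X')).
Proof.
apply/measurable_prod_spaceP => i; rewrite /joint /freeze.
by case: ifP => _; [exact: mX|exact: mX'].
Qed.

Lemma measurable_subvector v (Z : forall i, T -> E i) :
  (forall i, measurable_fun setT (Z i)) -> measurable_fun setT (subvector v Z).
Proof. by move=> mZ; apply/measurable_prod_spaceP => i; exact: mZ. Qed.

Lemma mutually_independent_split (A : forall i, set (E i)) :
  (forall i, measurable (A i)) ->
  P (joint X @^-1` box A) =
  (P (\bigcap_(i in [set` u]) (X i @^-1` A i)) *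
   P (\bigcap_(i in [set` ~: u]) (X i @^-1` A i)))%E.
Proof.
move=> mA; rewrite !X_indep//.
have := @X_indep [set: I]%SET A.
rewrite (bigID (mem u))/= => e; rewrite -[RHS](_ : (\prod_(i in [set: I]%SET | i \in u) P (X i @^-1` A i) *
  \prod_(i in [set: I]%SET | i \notin u) P (X i @^-1` A i))%E = _); last first.
  by congr (_ * _)%E; apply: eq_bigl => i; rewrite !inE.
rewrite -e//; congr (P _); apply/seteqP; split=> w /= Aw i.
  by move=> _; exact: Aw.
by apply: Aw; rewrite /= inE.
Qed.

Lemma joint_freeze_law : same_law P (joint (freeze u X X')) P (joint X).
Proof.
pose J1 : {mfun T >-> prod_space E} :=
  HB.pack (joint (freeze u X X')) (isMeasurableFun.Build _ _ _ _ _ measurable_joint_freeze).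
pose J2 : {mfun T >-> prod_space E} :=
  HB.pack (joint X) (isMeasurableFun.Build _ _ _ _ _ measurable_joint).
apply: (@box_measure_unique R I dE E (distribution P J1) (distribution P J2)).
  by rewrite (le_lt_trans (probability_le1 _ measurableT))// ltry.
move=> A mA.
suff : P (joint (freeze u X X') @^-1` box A) = P (joint X @^-1` box A) by [].
rewrite mutually_independent_split//.
(* The sides outside u are made full so that the event concerns [joint X], the vector of which
   [X'_indep] speaks. *)
pose A1 i := if i \in u then A i else setT.
have mA1 : measurable (box A1).
  by apply: measurable_box => i; rewrite /A1; case: ifP.
pose A2 : forall i : {i : I | i \in ~: u}, set (E (val i)) := fun i => A (val i).
have mA2 : measurable (box A2 : set (subproduct E (~: u))).
  by apply: measurable_box.
rewrite (_ : _ @^-1` _ = joint X @^-1` box A1 `&` subvector (~: u) X' @^-1` box A2); last first.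
  apply/seteqP; split=> w /=.
    move=> Aw; split=> i.
      by have := Aw i; rewrite /A1 /joint /freeze; case: ifP.
    have := Aw (val i); rewrite /A2 /joint /freeze/=.
    by have := valP i; rewrite /= inE => /negbTE ->.
  move=> [A1w A2w] i; have := A1w i; rewrite /A1 /joint /freeze.
  have [//|niu _] := boolP (i \in u).
  have iu' : i \in ~: u by rewrite inE.
  exact: (A2w (exist _ i iu')).
rewrite X'_indep// X'_copy//; congr (P _ * P _)%E; apply/seteqP; split=> w /= Aw.
- by move=> i iu; have := Aw i; rewrite /A1 iu.
- by move=> i; rewrite /A1; case: ifP => // iu; exact: Aw.
- by move=> i iu; exact: (Aw (exist _ i iu)).
- by move=> i; exact: Aw (valP i).
Qed.

Lemma freeze_Rintegral (phi : prod_space E -> R) M : measurable_fun setT phi ->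
  (forall x, `|phi x| <= M) ->
  \int[P]_w phi (joint (freeze u X X') w) = \int[P]_w phi (joint X w).
Proof.
move=> mphi phiM.
exact: same_law_Rintegral measurable_joint_freeze measurable_joint mphi phiM joint_freeze_law.
Qed.

Variables (g : prod_space E -> R) (Z : T -> R) (M : R).
Hypotheses (mg : measurable_fun setT g) (gM : forall x, `|g x| <= M)
  (ZM : forall w, `|Z w| <= M)
  (gZ : cond_expectation P (subvector u X) (g \o joint X) Z).

Let Y := g \o joint X.
Let Yu := g \o joint (freeze u X X').

Let mY : measurable_fun setT Y.
Proof. exact: measurableT_comp mg measurable_joint. Qed.

Let mYu : measurable_fun setT Yu.
Proof. exact: measurableT_comp mg measurable_joint_freeze. Qed.

Let YM w : `|Y w| <= M. Proof. exact: gM. Qed.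

Let YuM w : `|Yu w| <= M. Proof. exact: gM. Qed.

Let mXu : measurable_fun setT (subvector u X).
Proof. exact: measurable_subvector. Qed.

Let sZ : measurable_fun [set: g_sigma_algebra_preimageType (subvector u X)] Z.
Proof. by have [] := gZ. Qed.

Let mZ : measurable_fun setT Z.
Proof. exact: (measurable_fun_of_preimage mXu sZ). Qed.

(** An event of sigma(X_u) is read on coordinates that freezing leaves alone. Integrating over it is
    integrating a function of the whole vector, whose law is invariant under freezing. *)
Lemma cond_expectation_freeze : cond_expectation P (subvector u X) Yu Z.
Proof.
have [mZ' iZ ZY] := gZ; split=> // A sA; rewrite ZY//.
have mA := measurable_of_preimage mXu sA.
have [C mC CA] := sA; rewrite setTI in CA.
have iY' : P.-integrable setT (EFin \o Y) by exact: bounded_integrable mY YM.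
have iYu' : P.-integrable setT (EFin \o Yu) by exact: bounded_integrable mYu YuM.
have iY : P.-integrable A (EFin \o Y) := integrableS measurableT mA (@subsetT _ _) iY'.
have iYu : P.-integrable A (EFin \o Yu) := integrableS measurableT mA (@subsetT _ _) iYu'.
rewrite -[LHS](EFin_Rintegral mA iY) -(EFin_Rintegral mA iYu); congr EFin.
pose B := restrict_to u @^-1` C.
have mB : measurable B.
  by rewrite -[X in measurable X]setTI; exact: measurable_restrict_to.
have mphi : measurable_fun setT (g \_ B).
  by apply/(measurable_restrictT _ mB); exact: measurable_funTS.
have phiM x : `|(g \_ B) x| <= M.
  by rewrite patchE; case: ifP => // _; rewrite normr0 (le_trans _ (gM x)).
rewrite [LHS]Rintegral_mkcond [RHS]Rintegral_mkcond.
transitivity (\int[P]_w (g \_ B) (joint X w)).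
  by apply: eq_Rintegral => w _; rewrite !patchE -CA.
rewrite -(freeze_Rintegral mphi phiM).
apply: eq_Rintegral => w _; rewrite !patchE -CA.
have e : restrict_to u (joint (freeze u X X') w) = subvector u X w.
  apply/functional_extensionality_dep => i.
  by rewrite /restrict_to /joint /freeze (valP i).
congr (if _ then _ else _).
by apply/idP/idP; rewrite !in_setE /B /preimage/= e.
Qed.

Let bounded_mul (f1 f2 : T -> R) : measurable_fun setT f1 -> measurable_fun setT f2 ->
  (forall w, `|f1 w| <= M) -> (forall w, `|f2 w| <= M) ->
  P.-integrable setT (EFin \o (fun w => f1 w * f2 w)).
Proof.
move=> mf1 mf2 f1M f2M; apply: (bounded_integrable (M := M * M)) => [|w].
  exact: measurable_funM.
by rewrite normrM ler_pM.
Qed.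

(* Condition on X'_{~u}: once it is fixed, Y^u is a function of X_u. *)
Lemma independent_fixed_part :
  \int[P]_w (Y w * Yu w) = \int[P]_w (Z w * Yu w).
Proof.
(* [S] is [T] with the sigma-algebra of [joint X]. The identity into [S] serves as a random variable
   independent of X'_{~u}, so that [Z] is a function of it without having to be factored through
   [X]. *)
pose S := g_sigma_algebra_preimageType (joint X).
have mXS : measurable_fun setT (joint X : S -> prod_space E).
  exact: measurable_fun_preimageType.
have mid : measurable_fun setT (id : T -> S).
  move=> _ B sB; rewrite setTI; exact: (measurable_of_preimage measurable_joint sB).
have mX'u : measurable_fun setT (subvector (~: u) X') by exact: measurable_subvector.
have ind : independent2 P (subvector (~: u) X') (id : T -> S).
  move=> A B mA [C mC]; rewrite setTI => <-.
  by rewrite setIC muleC; exact: X'_indep.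
have mZS : measurable_fun setT (Z : S -> R).
  move=> _ B mB; have [C mC] := sZ measurableT mB.
  rewrite !setTI => <-; exists (restrict_to u @^-1` C) => //.
    by rewrite -[X in measurable X]setTI; exact: measurable_restrict_to.
  by rewrite setTI.
pose h (z : subproduct E (~: u) * S) :=
  (Y z.2 - Z z.2) * g (overwrite z.1 (joint X z.2)).
have mh : measurable_fun setT h.
  apply: measurable_funM.
    apply: measurable_funB.
      exact: measurableT_comp (measurableT_comp mg mXS) measurable_snd.
    exact: measurableT_comp mZS measurable_snd.
  apply: measurableT_comp => //; apply: measurable_overwrite.
    exact: measurable_fst.
  move=> i _; exact: measurableT_comp (measurableT_comp (measurable_coord i) mXS) measurable_snd.
have hM z : `|h z| <= (M + M) * M.
  by rewrite /h normrM ler_pM// (le_trans (ler_normB _ _))// lerD.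
apply/eqP; rewrite -subr_eq0 -RintegralB//; [|exact: bounded_mul..].
rewrite (_ : (fun w => _) = fun w => h (subvector (~: u) X' w, w)); last first.
  by apply/funext => w; rewrite /h/= -freezeE mulrBl.
rewrite (independent2_Rintegral mX'u mid ind mh hM); apply/eqP.
transitivity (\int[P]_w (0 : R)); last by rewrite Rintegral_constT.
apply: eq_Rintegral => w _; rewrite /h/=.
set b := subvector _ _ w.
under eq_Rintegral do rewrite mulrBl.
(* For fixed [b] the resampled value reads only X_u, so it is an admissible factor in the
   conditional expectation. *)
have sgb : measurable_fun [set: g_sigma_algebra_preimageType (subvector u X)]
    (fun w' => g (overwrite b (joint X w'))).
  apply: measurableT_comp => //; apply: measurable_overwrite => //.
  move=> i; rewrite inE negbK => iu.
  by have /measurable_prod_spaceP/(_ (exist _ i iu)) :=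
    @measurable_fun_preimageType _ _ T _ (subvector u X).
have mgb := measurable_fun_of_preimage mXu sgb.
rewrite RintegralB//; [|exact: bounded_mul..].
apply/eqP; rewrite subr_eq0; apply/eqP.
exact: (cond_expectation_mul mXu mY YM ZM gZ sgb).
Qed.

(** [Z] enters twice: as a version of the conditional expectation of Y^u, and as the bounded
    sigma(X_u)-measurable factor that multiplies it. *)
Lemma Rintegral_mul_freeze : \int[P]_w (Y w * Yu w) = \int[P]_w (Z w * Z w).
Proof.
rewrite independent_fixed_part -(cond_expectation_mul mXu mYu YuM ZM cond_expectation_freeze sZ ZM)//.
by apply: eq_Rintegral => w _; rewrite mulrC.
Qed.

Lemma Rintegral_version : \int[P]_w Z w = \int[P]_w Y w.
Proof.
rewrite /Rintegral; congr fine; have [_ _ ->//] := gZ.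
by exists setT => //; rewrite setTI.
Qed.

Let Rintegral_sqr_freeze : \int[P]_w (Yu w * Yu w) = \int[P]_w (Y w * Y w).
Proof.
apply: (freeze_Rintegral (phi := fun x => g x * g x) (M := M * M)).
  exact: measurable_funM.
by move=> x; rewrite normrM ler_pM.
Qed.

Lemma Rintegral_half_sum_freeze :
  \int[P]_w ((Y w + Yu w) / 2) = \int[P]_w Y w.
Proof.
have iY := bounded_integrable (P := P) mY YM.
have iYu := bounded_integrable (P := P) mYu YuM.
have e : \int[P]_w Yu w = \int[P]_w Y w by exact: freeze_Rintegral.
rewrite RintegralZr//; last exact: (integrableD measurableT iY iYu).
by rewrite RintegralD// e; field.
Qed.

Lemma Rintegral_half_sum_sqr_freeze :
  \int[P]_w (((Y w + Yu w) / 2) ^+ 2) =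
  (\int[P]_w (Y w * Y w) + \int[P]_w (Z w * Z w)) / 2.
Proof.
have i1 := bounded_mul mY mY YM YM; have i2 := bounded_mul mY mYu YM YuM.
have i3 := bounded_mul mYu mYu YuM YuM.
rewrite (_ : (fun w => _) = fun w => 4^-1 * (Y w * Y w) + 2^-1 * (Y w * Yu w) + 4^-1 * (Yu w * Yu w)).
  rewrite RintegralD//; last 2 first.
  - exact: (integrableD measurableT (integrableZl measurableT 4^-1 i1) (integrableZl measurableT 2^-1 i2)).
  - exact: (integrableZl measurableT 4^-1 i3).
  rewrite RintegralD//; last 2 first.
  - exact: (integrableZl measurableT 4^-1 i1).
  - exact: (integrableZl measurableT 2^-1 i2).
  by rewrite !RintegralZl// Rintegral_sqr_freeze Rintegral_mul_freeze; field.
by apply/funext => w; field.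
Qed.

Lemma Rintegral_half_diff_sqr_freeze :
  \int[P]_w (((Y w - Yu w) / 2) ^+ 2) =
  (\int[P]_w (Y w * Y w) - \int[P]_w (Z w * Z w)) / 2.
Proof.
have i1 := bounded_mul mY mY YM YM; have i2 := bounded_mul mY mYu YM YuM.
have i3 := bounded_mul mYu mYu YuM YuM.
rewrite (_ : (fun w => _) = fun w => 4^-1 * (Y w * Y w) - 2^-1 * (Y w * Yu w) + 4^-1 * (Yu w * Yu w)).
  rewrite RintegralD//; last 2 first.
  - exact: (integrableB measurableT (integrableZl measurableT 4^-1 i1) (integrableZl measurableT 2^-1 i2)).
  - exact: (integrableZl measurableT 4^-1 i3).
  rewrite RintegralB//; last 2 first.
  - exact: (integrableZl measurableT 4^-1 i1).
  - exact: (integrableZl measurableT 2^-1 i2).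
  by rewrite !RintegralZl// Rintegral_sqr_freeze Rintegral_mul_freeze; field.
by apply/funext => w; field.
Qed.

End freezing.

(** * The pick and freeze statistic *)

Section sample_statistics.
Context (R : realType) (N k : nat).
Implicit Types h q : 'I_N -> 'I_k -> R.

(** Normalised by N and not by N - 1, hence biased. *)
Definition sample_variance h : R :=
  \sum_(l < k) (N%:R^-1 * (\sum_(i < N) h i l ^+ 2) -
                (N%:R^-1 * \sum_(i < N) h i l) ^+ 2).

Definition sample_square q : R :=
  \sum_(l < k) N%:R^-1 * (\sum_(i < N) q i l ^+ 2).

(** For two components a and b with half sum h and half difference q, a b = h^2 - q^2 and (a^2 +
    b^2) / 2 = h^2 + q^2; the same squared mean of h is subtracted above and below. *)
Lemma pick_freezeE (s : 'I_N -> k.-tuple R * k.-tuple R)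
    (h := fun i l => (tnth (s i).1 l + tnth (s i).2 l) / 2)
    (q := fun i l => (tnth (s i).1 l - tnth (s i).2 l) / 2) :
  pick_freeze s = (sample_variance h - sample_square q) /
                  (sample_variance h + sample_square q).
Proof.
rewrite /pick_freeze /sample_variance /sample_square; congr (_ / _).
  rewrite -sumrB; apply: eq_bigr => l _; rewrite addrAC -mulrBr -sumrB.
  by congr (_ * _ - _); apply: eq_bigr => i _; rewrite /h /q; field.
rewrite -big_split; apply: eq_bigr => l _; rewrite /= addrAC -mulrDr -big_split.
by congr (_ * _ - _); apply: eq_bigr => i _; rewrite /h /q /=; field.
Qed.

Hypothesis N_gt0 : (0 < N)%N.

(** The pair form shows nonnegativity, reduces the mean to moments of two observations, and confines
    a change of one observation to the pairs that contain it. *)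
Lemma sample_variance_pairs h :
  sample_variance h =
  (2 * N%:R ^+ 2)^-1 * \sum_(i < N) \sum_(j < N) \sum_(l < k) (h i l - h j l) ^+ 2.
Proof.
have NR0 : N%:R != 0 :> R by rewrite pnatr_eq0 -lt0n.
under [X in _ * X]eq_bigr do rewrite exchange_big/=.
rewrite exchange_big/= mulr_sumr; apply: eq_bigr => l _.
set A := \sum_(i < N) h i l ^+ 2; set B := \sum_(i < N) h i l.
have -> : \sum_(i < N) \sum_(j < N) (h i l - h j l) ^+ 2 = 2 * (N%:R * A - B ^+ 2).
  transitivity (\sum_(i < N) (N%:R * h i l ^+ 2 + A - 2 * B * h i l)).
    apply: eq_bigr => i _.
    under eq_bigr do rewrite sqrrB.
    rewrite big_split/= sumrB sumr_const card_ord -mulr_natl -/A.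
    rewrite sumrMnl -mulr_sumr -/B; ring.
  rewrite sumrB big_split/= sumr_const card_ord -!mulr_sumr -/A -/B -mulr_natl; ring.
by field.
Qed.

Lemma sample_variance_ge0 h : 0 <= sample_variance h.
Proof.
rewrite sample_variance_pairs mulr_ge0 ?invr_ge0 ?mulr_ge0 ?exprn_ge0//.
by do 3 apply: sumr_ge0 => ? _; exact: sqr_ge0.
Qed.

Lemma sample_square_ge0 q : 0 <= sample_square q.
Proof.
apply: sumr_ge0 => l _; rewrite mulr_ge0 ?invr_ge0//.
by apply: sumr_ge0 => i _; exact: sqr_ge0.
Qed.

Lemma sample_variance_le_square h : sample_variance h <= sample_square h.
Proof. by apply: ler_sum => l _; rewrite gerBl sqr_ge0. Qed.

Lemma sample_square_le q (B : R) :
  (forall i, \sum_(l < k) q i l ^+ 2 <= B) -> sample_square q <= B.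
Proof.
move=> qB; rewrite /sample_square -mulr_sumr exchange_big/=.
rewrite ler_pdivrMl ?ltr0n//; apply: (@le_trans _ _ (\sum_(i < N) B)).
  exact: ler_sum.
by rewrite sumr_const card_ord mulr_natl.
Qed.

(** Each pair contributes between 0 and 4 B, and at most 2 N ordered pairs contain [i0]; the
    prefactor 1 / (2 N^2) then gives 4 B / N. *)
Lemma sample_variance_diff h h' (B : R) i0 :
  (forall i l, i != i0 -> h i l = h' i l) ->
  (forall i, \sum_(l < k) h i l ^+ 2 <= B) ->
  (forall i, \sum_(l < k) h' i l ^+ 2 <= B) ->
  `|sample_variance h - sample_variance h'| <= 4 * B / N%:R.
Proof.
move=> hh' hB hB'; have NR0 : 0 < N%:R :> R by rewrite ltr0n.
rewrite !sample_variance_pairs -mulrBr normrM ger0_norm; last first.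
  by rewrite invr_ge0 mulr_ge0 ?exprn_ge0.
rewrite -sumrB.
under eq_bigr do rewrite -sumrB.
have bnd (g : 'I_N -> 'I_k -> R) : (forall i, \sum_(l < k) g i l ^+ 2 <= B) -> forall i j,
    0 <= \sum_(l < k) (g i l - g j l) ^+ 2 <= 4 * B.
  move=> gB i j; rewrite sumr_ge0//=; last by move=> l _; exact: sqr_ge0.
  apply: (@le_trans _ _ (\sum_(l < k) (2 * g i l ^+ 2 + 2 * g j l ^+ 2))).
    by apply: ler_sum => l _; have := sqr_ge0 (g i l + g j l); rewrite !expr2; lra.
  rewrite big_split/= -!mulr_sumr; have := gB i; have := gB j; lra.
(* The bound is spread over the pairs, each weighted by the number of its members equal to [i0], so
   that the sums are compared term by term. *)
have -> : 4 * B / N%:R = (2 * N%:R ^+ 2)^-1 *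
    \sum_(i < N) \sum_(j < N) 4 * B * ((i == i0)%:R + (j == i0)%:R).
  have delta : \sum_(i < N) (i == i0)%:R = 1 :> R.
    by rewrite (bigD1 i0)//= eqxx big1 ?addr0// => i /negbTE ->.
  under eq_bigr do rewrite -mulr_sumr big_split/= delta sumr_const card_ord -(mulr_natl _ N).
  rewrite -mulr_sumr big_split/= -mulr_sumr delta sumr_const card_ord -(mulr_natl _ N).
  by field; rewrite gt_eqF.
rewrite ler_wpM2l ?invr_ge0 ?mulr_ge0 ?exprn_ge0//.
apply: le_trans (ler_norm_sum _ _ _) _; apply: ler_sum => i _.
apply: le_trans (ler_norm_sum _ _ _) _; apply: ler_sum => j _.
have /andP[d0 dB] := bnd _ hB i j; have /andP[d0' dB'] := bnd _ hB' i j.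
have B0 : 0 <= 4 * B := le_trans d0 dB.
have [ii|ii] := eqVneq i i0.
  rewrite ler_norml mulr1n; case: (j == i0); rewrite ?mulr1n ?mulr0n; apply/andP; split; lra.
have [jj|jj] := eqVneq j i0.
  by rewrite ler_norml mulr1n mulr0n; apply/andP; split; lra.
rewrite (eq_bigr (fun l => (h' i l - h' j l) ^+ 2)) ?subrr ?normr0 ?mulr0n ?addr0 ?mulr0//.
by move=> l _; rewrite !hh'.
Qed.

Lemma sample_square_diff q q' (B : R) i0 :
  (forall i l, i != i0 -> q i l = q' i l) ->
  (forall i, \sum_(l < k) q i l ^+ 2 <= B) ->
  (forall i, \sum_(l < k) q' i l ^+ 2 <= B) ->
  `|sample_square q - sample_square q'| <= B / N%:R.
Proof.
move=> qq' qB qB'; rewrite /sample_square -!mulr_sumr -mulrBr normrM.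
rewrite ger0_norm ?invr_ge0// [leRHS]mulrC ler_wpM2l ?invr_ge0//.
rewrite exchange_big [X in _ - X]exchange_big/= (bigD1 i0)//= [X in _ - X](bigD1 i0)//=.
have -> : \sum_(i < N | i != i0) \sum_(l < k) q i l ^+ 2 =
          \sum_(i < N | i != i0) \sum_(l < k) q' i l ^+ 2.
  by apply: eq_bigr => i ii; apply: eq_bigr => l _; rewrite qq'.
have Q0 (g : 'I_N -> 'I_k -> R) : 0 <= \sum_(l < k) g i0 l ^+ 2.
  by apply: sumr_ge0 => l _; exact: sqr_ge0.
have := qB i0; have := qB' i0; have := Q0 q; have := Q0 q'.
by rewrite ler_norml; move=> *; apply/andP; split; lra.
Qed.

End sample_statistics.

Lemma mutually_independent_pair (R : realType) d d' (T : measurableType d)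
    (V : measurableType d') (P : probability T R) (I : finType) (W : I -> T -> V)
    i j : i != j ->
  mutually_independent P (E := fun=> V) W -> independent2 P (W i) (W j).
Proof.
move=> ij indW A B mA mB.
have := @indW [set i; j]%SET (fun m => if m == i then A else B).
rewrite big_setU1/= ?inE// big_set1 eqxx eq_sym (negbTE ij) => <-; last first.
  by move=> m _; case: ifP.
congr (P _); apply/seteqP; split=> w /=.
  move=> [wA wB] m; rewrite /= !inE => /orP[] /eqP ->; first by rewrite eqxx.
  by rewrite eq_sym (negbTE ij).
move=> wAB; split.
  by have := wAB i; rewrite /= eqxx; apply; rewrite !inE eqxx.
by have := wAB j; rewrite /= eq_sym (negbTE ij); apply; rewrite !inE eqxx orbT.
Qed.

(** * Means of the sample statistics *)

Section sample_means.
Context (R : realType) (N k : nat) d (T : measurableType d) (P : probability T R).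
Hypothesis N_gt0 : (0 < N)%N.
Variables (h : 'I_N -> T -> 'I_k -> R) (M : R).
Hypotheses (mh : forall i l, measurable_fun setT (fun w => h i w l))
  (hM : forall i w l, `|h i w l| <= M).

Let ihh i j l : P.-integrable setT (EFin \o (fun w => h i w l * h j w l)).
Proof.
apply: (bounded_integrable (M := M * M)); first exact: measurable_funM.
by move=> w; rewrite normrM ler_pM.
Qed.

(** In the pair form the diagonal vanishes and each of the N (N - 1) other pairs contributes 2 (s -
    m^2) per component; dividing by 2 N^2 leaves the factor 1 - 1/N. *)
Lemma Rintegral_sample_variance (s m : 'I_k -> R) :
  (forall i l, \int[P]_w (h i w l ^+ 2) = s l) ->
  (forall i j l, i != j -> \int[P]_w (h i w l * h j w l) = m l ^+ 2) ->
  \int[P]_w sample_variance (fun i l => h i w l) =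
  (1 - N%:R^-1) * \sum_(l < k) (s l - m l ^+ 2).
Proof.
move=> hs hm.
under eq_Rintegral do rewrite sample_variance_pairs//.
pose D i j l w := (h i w l - h j w l) ^+ 2.
have ED i j l w : D i j l w = h i w l * h i w l + (- 2) * (h i w l * h j w l) + h j w l * h j w l.
  by rewrite /D; ring.
have iZ i j l c : P.-integrable setT (EFin \o (fun w => c * (h i w l * h j w l))).
  exact: (integrableZl measurableT c (ihh i j l)).
have iDD i j l : P.-integrable setT (EFin \o (fun w => h i w l * h i w l + (- 2) * (h i w l * h j w l))).
  exact: (integrableD measurableT (ihh i i l) (iZ i j l (-2))).
have iD i j l : P.-integrable setT (EFin \o D i j l).
  rewrite (_ : D i j l = fun w => h i w l * h i w l + (- 2) * (h i w l * h j w l) + h j w l * h j w l).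
    exact: (integrableD measurableT (iDD i j l) (ihh j j l)).
  by apply/funext => w; exact: ED.
have isum (J : Type) (r : seq J) (f : J -> T -> R) :
    (forall j, P.-integrable setT (EFin \o f j)) ->
    P.-integrable setT (EFin \o fun w => \sum_(j <- r) f j w).
  move=> fi; rewrite (_ : _ \o _ = fun w => (\sum_(j <- r) (f j w)%:E)%E); last first.
    by apply/funext => w /=; rewrite sumEFin.
  by apply: integrable_sum => // j _; exact: fi.
rewrite RintegralZl//; last first.
  by apply: (isum) => i; apply: (isum) => j; apply: (isum) => l; exact: iD.
rewrite Rintegral_sum; last first.
  by move=> i; apply: (isum) => j; apply: (isum) => l; exact: iD.
have intD i j l : \int[P]_w D i j l w = (i != j)%:R * (2 * (s l - m l ^+ 2)).
  have hs' i' : \int[P]_w (h i' w l * h i' w l) = s l by rewrite -(hs i').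
  have [->|ij] := eqVneq i j.
    under eq_Rintegral do rewrite /D subrr expr0n/=.
    by rewrite Rintegral_constT mul0r.
  under eq_Rintegral do rewrite ED.
  rewrite RintegralD// RintegralD// RintegralZl// !hs' hm//=; ring.
under eq_bigr => i _.
  rewrite Rintegral_sum; last by move=> j; apply: (isum) => l; exact: iD.
  under eq_bigr => j _.
    rewrite Rintegral_sum; last by move=> l; exact: iD.
    under eq_bigr do rewrite intD.
    rewrite -mulr_sumr -mulr_sumr.
    over.
  rewrite -mulr_suml.
  over.
rewrite -mulr_suml.
have -> : \sum_(i < N) \sum_(j < N) (i != j)%:R = N%:R * (N%:R - 1) :> R.
  have row (i : 'I_N) : \sum_(j < N) (i != j)%:R = N%:R - 1 :> R.
    rewrite (bigD1 i)//= eqxx add0r.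
    under eq_bigr => j ij do rewrite eq_sym ij.
    rewrite sumr_const cardC1 card_ord -subn1 natrB//.
  under eq_bigr do rewrite row.
  by rewrite sumr_const card_ord mulr_natl.
by field; rewrite pnatr_eq0 -lt0n.
Qed.

Lemma Rintegral_sample_square (s : 'I_k -> R) :
  (forall i l, \int[P]_w (h i w l ^+ 2) = s l) ->
  \int[P]_w sample_square (fun i l => h i w l) = \sum_(l < k) s l.
Proof.
move=> hs; rewrite /sample_square.
have isq i l : P.-integrable setT (EFin \o fun w => h i w l ^+ 2) by exact: ihh.
have isum l : P.-integrable setT (EFin \o fun w => \sum_(i < N) h i w l ^+ 2).
  rewrite (_ : _ \o _ = fun w => (\sum_(i < N) (h i w l ^+ 2)%:E)%E); last first.
    by apply/funext => w /=; rewrite sumEFin.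
  by apply: integrable_sum => // i _; exact: isq.
rewrite Rintegral_sum; last by move=> l; exact: (integrableZl measurableT _ (isum l)).
apply: eq_bigr => l _; rewrite RintegralZl// Rintegral_sum//.
under eq_bigr do rewrite hs.
rewrite sumr_const card_ord -[s l *+ N]mulr_natl mulKf// pnatr_eq0 -lt0n//.
Qed.

End sample_means.

(** * Clamping to the ball of radius rho *)

Section clamping.
Context (R : realType) (N k : nat) (rho : R).
Hypothesis rho_gt0 : 0 < rho.
Notation V := (k.-tuple R * k.-tuple R)%type.

(** The test bears on the whole vector, so that the squared norm, and not just each component, is
    bounded. Sending the outside to 0 rather than projecting makes measurability immediate. *)
Definition clamp (y : k.-tuple R) (l : 'I_k) : R :=
  if \sum_(m < k) tnth y m ^+ 2 <= rho ^+ 2 then tnth y l else 0.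

Lemma norm2_lt_sqr y : norm2 y < rho -> \sum_(m < k) tnth y m ^+ 2 <= rho ^+ 2.
Proof.
move=> yr; rewrite -[leLHS]sqr_sqrtr; last by apply: sumr_ge0 => m _; exact: sqr_ge0.
by rewrite ler_sqr ?nnegrE ?sqrtr_ge0 ?(ltW rho_gt0) ?(ltW yr).
Qed.

Lemma clamp_id y : \sum_(m < k) tnth y m ^+ 2 <= rho ^+ 2 -> clamp y = tnth y.
Proof. by move=> yr; apply/funext => l; rewrite /clamp ifT. Qed.

Lemma sum_clamp y : \sum_(l < k) clamp y l ^+ 2 <= rho ^+ 2.
Proof.
rewrite /clamp; have [//|_] := boolP (\sum_(m < k) tnth y m ^+ 2 <= rho ^+ 2).
by rewrite big1; [exact: sqr_ge0|move=> l _; rewrite expr0n].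
Qed.

Lemma clamp_le y l : `|clamp y l| <= rho.
Proof.
suff : `|clamp y l| ^+ 2 <= rho ^+ 2 by rewrite ler_sqr ?nnegrE ?(ltW rho_gt0).
rewrite -normrX ger0_norm ?sqr_ge0//.
apply: le_trans (sum_clamp y).
by rewrite (bigD1 l)//= lerDl; apply: sumr_ge0 => m _; exact: sqr_ge0.
Qed.

Lemma measurable_clamp l : measurable_fun setT (clamp ^~ l).
Proof.
apply: measurable_fun_ifT => //; last exact: measurable_tnth.
apply: measurable_fun_ler => //; apply: measurable_sum => m.
by apply: measurable_funX; exact: measurable_tnth.
Qed.

Definition half_sum (v : V) l : R := (clamp v.1 l + clamp v.2 l) / 2.
Definition half_diff (v : V) l : R := (clamp v.1 l - clamp v.2 l) / 2.

Lemma measurable_half_sum l : measurable_fun setT (half_sum ^~ l).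
Proof.
apply: measurable_funM => //; apply: measurable_funD.
  exact: measurableT_comp (measurable_clamp l) measurable_fst.
exact: measurableT_comp (measurable_clamp l) measurable_snd.
Qed.

Lemma measurable_half_diff l : measurable_fun setT (half_diff ^~ l).
Proof.
apply: measurable_funM => //; apply: measurable_funB.
  exact: measurableT_comp (measurable_clamp l) measurable_fst.
exact: measurableT_comp (measurable_clamp l) measurable_snd.
Qed.

Lemma half_sum_le v l : `|half_sum v l| <= rho.
Proof.
have := clamp_le v.1 l; have := clamp_le v.2 l; rewrite /half_sum !ler_norml.
by move=> /andP[? ?] /andP[? ?]; apply/andP; split; lra.
Qed.

Lemma half_diff_le v l : `|half_diff v l| <= rho.
Proof.
have := clamp_le v.1 l; have := clamp_le v.2 l; rewrite /half_diff !ler_norml.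
by move=> /andP[? ?] /andP[? ?]; apply/andP; split; lra.
Qed.

Lemma sum_half_sum v : \sum_(l < k) half_sum v l ^+ 2 <= rho ^+ 2.
Proof.
have := sum_clamp v.1; have := sum_clamp v.2.
suff : \sum_(l < k) half_sum v l ^+ 2 <=
    2^-1 * \sum_(l < k) clamp v.1 l ^+ 2 + 2^-1 * \sum_(l < k) clamp v.2 l ^+ 2 by lra.
rewrite !mulr_sumr -big_split; apply: ler_sum => l _; rewrite /half_sum/=.
by have := sqr_ge0 (clamp v.1 l - clamp v.2 l); rewrite !expr2; lra.
Qed.

Lemma sum_half_diff v : \sum_(l < k) half_diff v l ^+ 2 <= rho ^+ 2.
Proof.
have := sum_clamp v.1; have := sum_clamp v.2.
suff : \sum_(l < k) half_diff v l ^+ 2 <=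
    2^-1 * \sum_(l < k) clamp v.1 l ^+ 2 + 2^-1 * \sum_(l < k) clamp v.2 l ^+ 2 by lra.
rewrite !mulr_sumr -big_split; apply: ler_sum => l _; rewrite /half_diff/=.
by have := sqr_ge0 (clamp v.1 l + clamp v.2 l); rewrite !expr2; lra.
Qed.

End clamping.

Section measurable_statistics.
Context (R : realType) (N k : nat) d (T : measurableType d).
Variable h : T -> 'I_N -> 'I_k -> R.
Hypothesis mh : forall i l, measurable_fun setT (fun w => h w i l).

Lemma measurable_sample_variance : measurable_fun setT (fun w => sample_variance (h w)).
Proof.
apply: measurable_sum => l; apply: measurable_funB.
  by apply: measurable_funM => //; apply: measurable_sum => i; exact: measurable_funX.
by apply: measurable_funX; apply: measurable_funM => //; exact: measurable_sum.
Qed.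

Lemma measurable_sample_square : measurable_fun setT (fun w => sample_square (h w)).
Proof.
apply: measurable_sum => l; apply: measurable_funM => //.
by apply: measurable_sum => i; exact: measurable_funX.
Qed.

End measurable_statistics.

(** * Tail bound for a linear combination of the two statistics *)

Section statistic_tail.
Context (R : realType) (N k : nat) d (T : measurableType d) (P : probability T R)
  (rho : R).
Hypotheses (N_gt0 : (0 < N)%N) (rho_gt0 : 0 < rho).
Notation V := (k.-tuple R * k.-tuple R)%type.
Variable W : 'I_N -> T -> V.
Hypotheses (mW : forall i, measurable_fun setT (W i))
  (W_indep : mutually_independent P (E := fun=> V) W).
Variables (s m s' : 'I_k -> R).
Hypotheses
  (hs : forall i l, \int[P]_w half_sum rho (W i w) l ^+ 2 = s l)
  (hm : forall i l, \int[P]_w half_sum rho (W i w) l = m l)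
  (hs' : forall i l, \int[P]_w half_diff rho (W i w) l ^+ 2 = s' l).

Lemma Rintegral_half_sum_mul i j l : i != j ->
  \int[P]_w (half_sum rho (W i w) l * half_sum rho (W j w) l) = m l ^+ 2.
Proof.
move=> ij.
pose h (v : V * V) := half_sum rho v.1 l * half_sum rho v.2 l.
have mh : measurable_fun setT h.
  apply: measurable_funM.
    exact: measurableT_comp (measurable_half_sum rho l) measurable_fst.
  exact: measurableT_comp (measurable_half_sum rho l) measurable_snd.
have hM v : `|h v| <= rho * rho by rewrite normrM ler_pM// half_sum_le.
have mhW j' : measurable_fun setT (fun w => half_sum rho (W j' w) l).
  exact: measurableT_comp (measurable_half_sum rho l) (mW j').
have ih j' : P.-integrable setT (EFin \o (fun w => half_sum rho (W j' w) l)).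
  by apply: (bounded_integrable (M := rho)) => // w; exact: half_sum_le.
rewrite (independent2_Rintegral (mW i) (mW j) (mutually_independent_pair ij W_indep) mh hM) /h/=.
transitivity (\int[P]_w (half_sum rho (W i w) l * m l)).
  by apply: eq_Rintegral => w _; rewrite RintegralZl// hm.
by rewrite RintegralZr// hm expr2.
Qed.

Variables (alpha beta tau : R).
Hypotheses (weights : 4 * `|alpha| + `|beta| <= 8) (tau_ge0 : 0 <= tau)
  (mean : alpha * ((1 - N%:R^-1) * \sum_(l < k) (s l - m l ^+ 2)) +
          beta * \sum_(l < k) s' l = - tau).

Let var (v : 'I_N -> V) : R := sample_variance (fun i => half_sum rho (v i)).
Let sq (v : 'I_N -> V) : R := sample_square (fun i => half_diff rho (v i)).

(** The combination has mean [- tau], so to be nonnegative it must exceed its mean by [tau]. With c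
    = 8 rho^2 / N, the exponent tau^2 / (2 N c^2) is N tau^2 / (128 rho^4). *)
Lemma statistic_tail :
  (P [set w | (0 <= alpha * var (W ^~ w) + beta * sq (W ^~ w))%R] <=
   (expR (- (N%:R * tau ^+ 2 / (128 * rho ^+ 4))))%:E)%E.
Proof.
have NR0 : 0 < N%:R :> R by rewrite ltr0n.
pose F (v : power_space V N) := alpha * var v + beta * sq v.
(* Replacing one pair moves [var] by at most 4 rho^2 / N and [sq] by at most rho^2 / N; [weights]
   bounds the combination. *)
pose c := 8 * rho ^+ 2 / N%:R.
have c0 : 0 < c by rewrite divr_gt0// mulr_gt0// exprn_gt0.
have mvar : measurable_fun setT (var : power_space V N -> R).
  apply: measurable_sample_variance => i l.
  exact: measurableT_comp (measurable_half_sum rho l) (measurable_coord (E := fun=> V) i).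
have msq : measurable_fun setT (sq : power_space V N -> R).
  apply: measurable_sample_square => i l.
  exact: measurableT_comp (measurable_half_diff rho l) (measurable_coord (E := fun=> V) i).
have mF : measurable_fun setT F by apply: measurable_funD; exact: measurable_funM.
have Fdiff i v v' : (forall j, j != i -> v j = v' j) -> `|F v - F v'| <= c.
  move=> vv'; rewrite /F.
  have dvar : `|var v - var v'| <= 4 * rho ^+ 2 / N%:R.
    apply: (sample_variance_diff N_gt0 (i0 := i)) => [j l ji|j|j]; last 2 first.
    - exact: sum_half_sum.
    - exact: sum_half_sum.
    - by rewrite vv'.
  have dsq : `|sq v - sq v'| <= rho ^+ 2 / N%:R.
    apply: (sample_square_diff (i0 := i)) => [j l ji|j|j]; last 2 first.
    - exact: sum_half_diff.
    - exact: sum_half_diff.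
    - by rewrite vv'.
  have -> : alpha * var v + beta * sq v - (alpha * var v' + beta * sq v') =
    alpha * (var v - var v') + beta * (sq v - sq v') by ring.
  apply: (le_trans (ler_normD _ _)); rewrite !normrM.
  apply: (@le_trans _ _ (`|alpha| * (4 * rho ^+ 2 / N%:R) + `|beta| * (rho ^+ 2 / N%:R))).
    by rewrite lerD// ler_wpM2l.
  rewrite (_ : _ + _ = (4 * `|alpha| + `|beta|) * (rho ^+ 2 / N%:R)); last by ring.
  by rewrite /c -mulrA ler_wpM2r// divr_ge0 ?sqr_ge0 ?ler0n.
have var_le v : `|var v| <= rho ^+ 2.
  rewrite ger0_norm ?sample_variance_ge0// (le_trans (sample_variance_le_square _))//.
  by apply: sample_square_le => // i; exact: sum_half_sum.
have sq_le v : `|sq v| <= rho ^+ 2.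
  rewrite ger0_norm ?sample_square_ge0//.
  by apply: sample_square_le => // i; exact: sum_half_diff.
have FM v : `|F v| <= `|alpha| * rho ^+ 2 + `|beta| * rho ^+ 2.
  by rewrite (le_trans (ler_normD _ _))// !normrM lerD// ler_wpM2l.
have mWW : measurable_fun setT (fun w => W ^~ w : power_space V N).
  exact/measurable_prod_spaceP.
have EF : \int[P]_w F (W ^~ w) = - tau.
  have ivar := bounded_integrable (P := P) (measurableT_comp mvar mWW) (fun w => var_le (W ^~ w)).
  have isq := bounded_integrable (P := P) (measurableT_comp msq mWW) (fun w => sq_le (W ^~ w)).
  rewrite RintegralD//; last 2 first.
  - exact: (integrableZl measurableT alpha ivar).
  - exact: (integrableZl measurableT beta isq).
  rewrite !RintegralZl// -mean; congr (_ * _ + _ * _).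
    apply: (@Rintegral_sample_variance R N k _ T P N_gt0 (fun i w => half_sum rho (W i w)) rho) => //.
    - move=> i l; exact: measurableT_comp (measurable_half_sum rho l) (mW i).
    - by move=> i w l; exact: half_sum_le.
    - by move=> i j l ij; exact: Rintegral_half_sum_mul.
  apply: (@Rintegral_sample_square R N k _ T P N_gt0 (fun i w => half_diff rho (W i w)) rho) => //.
  - move=> i l; exact: measurableT_comp (measurable_half_diff rho l) (mW i).
  - by move=> i w l; exact: half_diff_le.
have := bounded_differences_tail N_gt0 c0 tau_ge0 mW W_indep mF FM Fdiff.
rewrite EF addNr (_ : tau ^+ 2 / (2 * N%:R * c ^+ 2) = N%:R * tau ^+ 2 / (128 * rho ^+ 4))//.
by rewrite /c; field; rewrite !gt_eqF.
Qed.

End statistic_tail.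

Lemma ratio_norm_le1 (R : realType) (v q : R) : 0 <= v -> 0 <= q ->
  `|(v - q) / (v + q)| <= 1.
Proof.
move=> v0 q0; have [e|vq] := eqVneq (v + q) 0; first by rewrite e invr0 mulr0 normr0.
have vq0 : 0 < v + q by rewrite lt_neqAle eq_sym vq addr_ge0.
rewrite normrM normfV (gtr0_norm vq0) ler_pdivrMr// mul1r.
by rewrite ler_norml; apply/andP; split; lra.
Qed.

(** Clearing the denominator. If v + q = 0 then v and q both vanish, and the conclusion holds
    whatever [a] is compared with. *)
Lemma ratio_ge (R : realType) (a v q : R) : 0 <= v -> 0 <= q ->
  a <= (v - q) / (v + q) -> 0 <= (1 - a) * v + - (1 + a) * q.
Proof.
move=> v0 q0; have [e _|vq] := eqVneq (v + q) 0.
  have -> : v = 0 by lra.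
  have -> : q = 0 by lra.
  by rewrite !mulr0 addr0.
have vq0 : 0 < v + q by rewrite lt_neqAle eq_sym vq addr_ge0.
rewrite ler_pdivlMr// -subr_ge0.
by rewrite (_ : v - q - _ = (1 - a) * v + - (1 + a) * q)//; ring.
Qed.

(** Exchanging v and q changes the sign of the quotient, so this is [ratio_ge] at [- a]. *)
Lemma ratio_le (R : realType) (a v q : R) : 0 <= v -> 0 <= q ->
  (v - q) / (v + q) <= a -> 0 <= - (1 - a) * v + (1 + a) * q.
Proof.
move=> v0 q0 qa; have := @ratio_ge _ (- a) q v q0 v0.
rewrite [q + v]addrC -(opprB v q) [_ / (v + q)]mulNr lerN2 => /(_ qa).
by rewrite opprK addrC.
Qed.

(** The quotient is replaced by a test without division; where [g] vanishes the quotient is 0 and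
    the test reads a <= 0. *)
Lemma measurable_ratio_ge (R : realType) d (T : measurableType d) (f g : T -> R)
    (a : R) : measurable_fun setT f -> measurable_fun setT g ->
  (forall w, 0 <= g w) -> measurable [set w | a <= f w / g w].
Proof.
move=> mf mg g0.
have mb : measurable_fun setT (fun w => if g w <= 0 then a <= 0 else a * g w <= f w).
  apply: measurable_fun_ifT => //; first exact: measurable_fun_ler.
  by apply: measurable_fun_ler => //; exact: measurable_funM.
rewrite (_ : [set w | _] = setT `&` (fun w => if g w <= 0 then a <= 0 else a * g w <= f w) @^-1` [set true]).
  exact: mb.
rewrite setTI; apply: eq_set => w; apply/propext; rewrite /preimage/=.
have [gw|gw] := leP (g w) 0; last by rewrite ler_pdivlMr.
have -> : g w = 0 by apply: le_anti; rewrite gw g0.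
by rewrite invr0 mulr0.
Qed.

(** * From the two statistics to the estimator *)

Section pick_freeze_tail.
Context (R : realType) (N k : nat) (d : measure_display) (T : measurableType d)
  (P : probability T R).
Context (rho : R) (W : 'I_N -> T -> (k.-tuple R * k.-tuple R)%type).
Hypotheses (N_gt0 : (0 < N)%N) (rho_gt0 : 0 < rho)
  (mW : forall i, measurable_fun setT (W i))
  (W_indep : mutually_independent P (E := fun=> (k.-tuple R * k.-tuple R)%type) W).
Hypothesis W_bounded : {ae P, forall w i,
  \sum_(l < k) tnth (W i w).1 l ^+ 2 <= rho ^+ 2 /\
  \sum_(l < k) tnth (W i w).2 l ^+ 2 <= rho ^+ 2}.
(** [A l], [B l] and [m l] stand for the means of Y_l^2, Z_l^2 and Y_l, so that [sigma] below is the
    trace of Sigma and [S_sigma] identifies S with the index. *)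
Variables (A B m : 'I_k -> R) (S : R).
Hypotheses
  (half_sum_mean : forall i l, \int[P]_w half_sum rho (W i w) l = m l)
  (half_sum_sqr : forall i l, \int[P]_w half_sum rho (W i w) l ^+ 2 = (A l + B l) / 2)
  (half_diff_sqr : forall i l, \int[P]_w half_diff rho (W i w) l ^+ 2 = (A l - B l) / 2).

Let sigma := \sum_(l < k) (A l - m l ^+ 2).

Hypotheses (sigma_gt0 : 0 < sigma) (S_ge0 : 0 <= S) (S_le1 : S <= 1)
  (S_sigma : \sum_(l < k) (B l - m l ^+ 2) = S * sigma).

Let h w i l := (tnth (W i w).1 l + tnth (W i w).2 l) / 2.
Let q w i l := (tnth (W i w).1 l - tnth (W i w).2 l) / 2.

Let var w := sample_variance (h w).
Let sq w := sample_square (q w).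

Let mcoord i l : measurable_fun setT (fun w => tnth (W i w).1 l).
Proof.
exact: measurableT_comp (measurableT_comp (measurable_tnth l) measurable_fst) (mW i).
Qed.

Let mcoord' i l : measurable_fun setT (fun w => tnth (W i w).2 l).
Proof.
exact: measurableT_comp (measurableT_comp (measurable_tnth l) measurable_snd) (mW i).
Qed.

Let mvar : measurable_fun setT var.
Proof.
apply: measurable_sample_variance => i l.
by apply: measurable_funM => //; exact: measurable_funD.
Qed.

Let msq : measurable_fun setT sq.
Proof.
apply: measurable_sample_square => i l.
by apply: measurable_funM => //; exact: measurable_funB.
Qed.

Let pick_freeze_le1 w : `|pick_freeze (W ^~ w)| <= 1.
Proof.
by rewrite pick_freezeE ratio_norm_le1 ?sample_variance_ge0 ?sample_square_ge0.
Qed.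

Lemma measurable_pick_freeze_ge a : measurable [set w | a <= pick_freeze (W ^~ w)].
Proof.
rewrite (_ : [set w | _] = [set w | a <= (var w - sq w) / (var w + sq w)]).
  apply: measurable_ratio_ge; [exact: measurable_funB|exact: measurable_funD|].
  by move=> w; rewrite addr_ge0 ?sample_variance_ge0 ?sample_square_ge0.
by apply/seteqP; split=> w /=; rewrite pick_freezeE.
Qed.

Lemma measurable_pick_freeze_le a : measurable [set w | pick_freeze (W ^~ w) <= a].
Proof.
rewrite (_ : [set w | _] = [set w | - a <= (sq w - var w) / (var w + sq w)]).
  apply: measurable_ratio_ge; [exact: measurable_funB|exact: measurable_funD|].
  by move=> w; rewrite addr_ge0 ?sample_variance_ge0 ?sample_square_ge0.
by apply/seteqP; split=> w /=; rewrite pick_freezeE -(opprB (var w)) mulNr lerN2.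
Qed.

(** Almost surely the raw sample coincides with its clamped version, to which [statistic_tail]
    applies. The two means are (1 - 1/N) (1 + S) / 2 sigma for V and (1 - S) / 2 sigma for Q. *)
Lemma pick_freeze_tail (alpha beta tau : R) (G : set T) : measurable G ->
  (forall w, G w -> 0 <= alpha * var w + beta * sq w) ->
  4 * `|alpha| + `|beta| <= 8 -> 0 <= tau ->
  alpha * ((1 - N%:R^-1) * ((1 + S) / 2 * sigma)) + beta * ((1 - S) / 2 * sigma) = - tau ->
  (P G <= (expR (- (N%:R * tau ^+ 2 / (128 * rho ^+ 4))))%:E)%E.
Proof.
move=> mG Gpos weights tau0 mean.
have sumh : \sum_(l < k) ((A l + B l) / 2 - m l ^+ 2) = (1 + S) / 2 * sigma.
  rewrite (_ : (1 + S) / 2 * sigma = 2^-1 * sigma + 2^-1 * (S * sigma)); last by field.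
  by rewrite -S_sigma /sigma !mulr_sumr -big_split; apply: eq_bigr => l _ /=; field.
have sumq : \sum_(l < k) ((A l - B l) / 2) = (1 - S) / 2 * sigma.
  rewrite (_ : (1 - S) / 2 * sigma = 2^-1 * sigma - 2^-1 * (S * sigma)); last by field.
  by rewrite -S_sigma /sigma !mulr_sumr -sumrB; apply: eq_bigr => l _ /=; field.
rewrite -sumh -sumq in mean.
have := statistic_tail N_gt0 rho_gt0 mW W_indep half_sum_sqr half_sum_mean half_diff_sqr weights tau0 mean.
apply: le_trans; apply: le_probability_ae => //.
  rewrite -[X in measurable X]setTI; apply: measurable_fun_le => //.
  apply: measurable_funD; apply: measurable_funM => //.
    apply: measurable_sample_variance => i l.
    exact: measurableT_comp (measurable_half_sum rho l) (mW i).
  apply: measurable_sample_square => i l.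
  exact: measurableT_comp (measurable_half_diff rho l) (mW i).
apply: filterS W_bounded => w Wb /Gpos; rewrite /= /var /sq.
have -> : (fun i => half_sum rho (W i w)) = h w.
  by apply/funext => i; have [? ?] := Wb i; apply/funext => l; rewrite /half_sum !clamp_id.
have -> : (fun i => half_diff rho (W i w)) = q w.
  by apply/funext => i; have [? ?] := Wb i; apply/funext => l; rewrite /half_diff !clamp_id.
by [].
Qed.

Lemma pick_freeze_upper_tail t : 0 <= t ->
  (P [set w | (t <= pick_freeze (W ^~ w) - S)%R] <=
   (expR (- (N%:R / 32 *
      ((t - (2 * N%:R)^-1 * (S + t - 1) * (S + 1)) /
       (1 + S + t + `|S + t - 1|) * (sigma / rho ^+ 2)) ^+ 2))%R)%:E)%E.
Proof.
have S0 := S_ge0; have S1 := S_le1.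
move=> t0; have NR1 : 1 <= N%:R :> R by rewrite ler1n.
have [a1|a1] := ltP 1 (S + t).
  rewrite (_ : [set w | _] = set0) ?measure0 ?lee_fin ?expR_ge0//.
  apply/seteqP; split=> w //= tS; have := pick_freeze_le1 w.
  by rewrite ler_norml => /andP[_]; lra.
(* Minus the mean of (1 - a) V - (1 + a) Q at a = S + t; it is nonnegative because S + t <= 1. *)
set tau := sigma * (t - (2 * N%:R)^-1 * (S + t - 1) * (S + 1)).
have tau0 : 0 <= tau.
  rewrite mulr_ge0 ?(ltW sigma_gt0)// subr_ge0 (le_trans _ t0)//.
  by rewrite mulr_le0_ge0 ?addr_ge0// mulr_ge0_le0 ?invr_ge0 ?mulr_ge0//; lra.
have -> : [set w | t <= pick_freeze (W ^~ w) - S] = [set w | S + t <= pick_freeze (W ^~ w)].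
  by apply/seteqP; split=> w /=; rewrite lerBrDl.
have := @pick_freeze_tail (1 - (S + t)) (- (1 + (S + t))) tau _ (measurable_pick_freeze_ge (S + t)).
rewrite [`|S + t - 1|]ler0_norm; last by lra.
(* The denominator being 2, both sides are N / 32 times the square of tau / (2 rho^2). *)
rewrite (_ : N%:R / 32 * _ ^+ 2 = N%:R * tau ^+ 2 / (128 * rho ^+ 4)); last first.
  by rewrite /tau; field; rewrite !gt_eqF//; lra.
apply=> //.
- move=> w; rewrite /= pick_freezeE; apply: ratio_ge; [exact: sample_variance_ge0|exact: sample_square_ge0].
- rewrite ger0_norm ?ler0_norm; lra.
- rewrite /tau; field; rewrite gt_eqF//; lra.
Qed.

Lemma pick_freeze_lower_tail t : (1 - S) * (1 + S) / (2 * N%:R - (1 + S)) <= t ->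
  (P [set w | (pick_freeze (W ^~ w) - S <= - t)%R] <=
   (expR (- (N%:R / 32 *
      ((t + (2 * N%:R)^-1 * (S - t - 1) * (S + 1)) /
       (1 + S - t + `|S - t - 1|) * (sigma / rho ^+ 2)) ^+ 2))%R)%:E)%E.
Proof.
have S0 := S_ge0; have S1 := S_le1.
move=> tS; have NR1 : 1 <= N%:R :> R by rewrite ler1n.
have D0 : 0 <= 2 * N%:R - (1 + S) by lra.
have t0 : 0 <= t.
  by rewrite (le_trans _ tS)// divr_ge0// mulr_ge0//; lra.
have [a1|a1] := ltP (S - t) (- 1).
  rewrite (_ : [set w | _] = set0) ?measure0 ?lee_fin ?expR_ge0//.
  apply/seteqP; split=> w //= tS'; have := pick_freeze_le1 w.
  by rewrite ler_norml => /andP[+ _]; lra.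
set tau := sigma * (t + (2 * N%:R)^-1 * (S - t - 1) * (S + 1)).
have tau0 : 0 <= tau.
  rewrite mulr_ge0 ?(ltW sigma_gt0)//.
  (* In this form the hypothesis on t is the nonnegativity of the second factor. *)
  rewrite (_ : _ + _ = (2 * N%:R)^-1 * (t * (2 * N%:R - (1 + S)) - (1 - S) * (1 + S))); last first.
    by field; rewrite gt_eqF//; lra.
  rewrite mulr_ge0 ?invr_ge0 ?mulr_ge0// subr_ge0.
  (* As 1 + S <= 2 <= 2 N, the denominator of the threshold vanishes only for N = S = 1, where the
     second factor is 0. *)
  move: D0; rewrite le_eqVlt => /predU1P[D0|D0]; last by rewrite -ler_pdivrMr.
  rewrite -D0 mulr0.
  have -> : S = 1 by lra.
  by rewrite subrr mul0r.
have -> : [set w | pick_freeze (W ^~ w) - S <= - t] = [set w | pick_freeze (W ^~ w) <= S - t].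
  by apply/seteqP; split=> w /=; rewrite lerBlDr [- t + S]addrC.
have := @pick_freeze_tail (- (1 - (S - t))) (1 + (S - t)) tau _ (measurable_pick_freeze_le (S - t)).
rewrite [`|S - t - 1|]ler0_norm; last by lra.
rewrite (_ : N%:R / 32 * _ ^+ 2 = N%:R * tau ^+ 2 / (128 * rho ^+ 4)); last first.
  by rewrite /tau; field; rewrite !gt_eqF//; lra.
apply=> //.
- move=> w; rewrite /= pick_freezeE; apply: ratio_le; [exact: sample_variance_ge0|exact: sample_square_ge0].
(* With a = S - t >= -1 the weight is 4 (1 - a) + (1 + a) = 5 - 3 a, which reaches the bound 8 at a
   = -1. *)
- rewrite normrN !ger0_norm; lra.
- rewrite /tau; field; rewrite gt_eqF//; lra.
Qed.

End pick_freeze_tail.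

(** * Reduction of the theorem to bounded representatives *)

Theorem proposition5p4 (R : realType) (p k : nat)
  (d : measure_display) (T : measurableType d) (P : probability T R)
  (dE : 'I_p -> measure_display) (E : forall i, measurableType (dE i))
  (X : forall i, {RV P >-> E i})
  (X_indep : mutually_independent P X)
  (f : prod_space E -> k.-tuple R) (f_meas : measurable_fun setT f)
  (u : {set 'I_p})
  (* X'_{~u}; the coordinates of X' in u play no role *)
  (X' : forall i, {RV P >-> E i})
  (X'_copy : same_law P (subvector (~: u) X') P (subvector (~: u) X))
  (X'_indep : independent2 P (joint X) (subvector (~: u) X'))
  (Z : T -> k.-tuple R)
  (N : nat) (N_gt0 : (0 < N)%N)
  (d' : measure_display) (T' : measurableType d') (P' : probability T' R)
  (W : 'I_N -> {RV P' >-> (k.-tuple R * k.-tuple R)%type})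
  (rho : R) (rho_gt0 : 0 < rho) :
  let Y : T -> k.-tuple R := f \o joint X in
  let Yu : T -> k.-tuple R := f \o joint (freeze u X X') in
  let Sigma := cov_mx P Y in
  let S := sobol_index P Y Z in
  let v l := Sigma l l / rho ^+ 2 in
  let S_N w := pick_freeze (fun i => W i w) in
  posdef_mx Sigma ->
  {ae P, forall w, norm2 (Y w) < rho} ->
  cond_expectation_vec P (subvector u X) Y Z ->
  (forall i, same_law P' (W i) P (fun w => (Y w, Yu w))) ->
  mutually_independent P' W ->
  (forall t : R, 0 <= t ->
    (P' [set w | (t <= S_N w - S)%R] <=
     (expR (- (N%:R / 32 *
        ((t - (2 * N%:R)^-1 * (S + t - 1) * (S + 1)) /
         (1 + S + t + `|S + t - 1|) * \sum_(l < k) v l) ^+ 2))%R)%:E)%E) /\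
  (forall t : R, (1 - S) * (1 + S) / (2 * N%:R - (1 + S)) <= t ->
    (P' [set w | (S_N w - S <= - t)%R] <=
     (expR (- (N%:R / 32 *
        ((t + (2 * N%:R)^-1 * (S - t - 1) * (S + 1)) /
         (1 + S - t + `|S - t - 1|) * \sum_(l < k) v l) ^+ 2))%R)%:E)%E).

Proof.
move=> Y Yu Sigma S v S_N _ Y_bounded Z_version W_law W_indep.
have mX i : measurable_fun setT (X i) by exact: measurable_funPT.
have mX' i : measurable_fun setT (X' i) by exact: measurable_funPT.
have mW i : measurable_fun setT (W i) by exact: measurable_funPT.
have mJ := measurable_joint mX.
have mJu := measurable_joint_freeze u mX mX'.
have mY : measurable_fun setT Y by exact: measurableT_comp f_meas mJ.
have mYu : measurable_fun setT Yu by exact: measurableT_comp f_meas mJu.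
(* [g l] is bounded everywhere, and along [X] it agrees almost surely with the l-th component of
   Y. *)
pose g l x := clamp rho (f x) l.
have mg l : measurable_fun setT (g l) by exact: measurableT_comp (measurable_clamp rho l) f_meas.
have gM l x : `|g l x| <= rho by exact: clamp_le.
pose y l w := g l (joint X w).
have my l : measurable_fun setT (y l) by exact: measurableT_comp (mg l) mJ.
have yM l w : `|y l w| <= rho by exact: gM.
have iy l := bounded_integrable (P := P) (my l) (yM l).
have Y_ball : {ae P, forall w, \sum_(m < k) tnth (Y w) m ^+ 2 <= rho ^+ 2}.
  by apply: filterS Y_bounded => w; exact: norm2_lt_sqr.
have Yy l : {ae P, forall w, tnth (Y w) l = y l w}.
  by apply: filterS Y_ball => w Yw; rewrite /y /g -[f _]/(Y w) clamp_id.
have mYl l : measurable_fun setT (fun w => tnth (Y w) l).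
  exact: measurableT_comp (measurable_tnth l) mY.
have mXu : measurable_fun setT (subvector u X) by exact: measurable_subvector.
have y_version l : cond_expectation P (subvector u X) (y l) (fun w => tnth (Z w) l).
  have [sZ iZ ZY] := Z_version l; split=> // A sA; rewrite ZY//.
  have mA := measurable_of_preimage mXu sA.
  apply: ae_eq_integral => //.
  - by apply: measurable_funTS; exact/measurable_EFinP.
  - by apply: measurable_funTS; exact/measurable_EFinP.
  - by apply: filterS (Yy l) => w /= ->.
(* The given [Z], still a version for the clamped [y l], is traded for a bounded version [z l],
   almost surely equal to its l-th component; the variances that define [S] are unchanged. *)
have := fun l => cond_expectation_clamp mXu (my l) (ltW rho_gt0) (yM l) (y_version l).
move=> /choice[z z_version].
have zM l w : `|z l w| <= rho by have [_ ] := z_version l.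
have yz l : cond_expectation P (subvector u X) (g l \o joint X) (z l) by have [] := z_version l.
have mz l : measurable_fun setT (z l).
  by have [sz _ _] := yz l; exact: measurable_fun_of_preimage sz.
pose A l := \int[P]_w (y l w * y l w).
pose B l := \int[P]_w (z l w * z l w).
pose m l := \int[P]_w y l w.
have SigmaE l : Sigma l l = A l - m l ^+ 2.
  by rewrite mxE; exact: variance_ae_bounded (mYl l) (my l) (yM l) (Yy l).
have ZE l : cov_mx P Z l l = B l - m l ^+ 2.
  rewrite mxE /m -[\int[P]_w y l w](Rintegral_version (yz l)).
  apply: (variance_ae_bounded (M := rho)) => //.
    have [sZ _ _] := Z_version l; exact: measurable_fun_of_preimage sZ.
  by have [_ _] := z_version l; apply: filterS => w ->.
have B_ge l : 0 <= B l - m l ^+ 2 by rewrite -ZE mxE fine_ge0// variance_ge0.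
have half_diff_moment l := Rintegral_half_diff_sqr_freeze mX mX' X_indep X'_copy X'_indep
  (mg l) (gM l) (zM l) (yz l).
(* The mean square of (Y_l - Y^u_l) / 2, after clamping, is (A l - B l) / 2; its nonnegativity gives
   S <= 1. *)
have A_ge l : B l - m l ^+ 2 <= A l - m l ^+ 2.
  have : 0 <= (A l - B l) / 2.
    rewrite -[leRHS]half_diff_moment; apply: Rintegral_ge0 => w _; exact: sqr_ge0.
  lra.
set sigma := \sum_(l < k) (A l - m l ^+ 2).
set kappa := \sum_(l < k) (B l - m l ^+ 2).
have kappa_ge0 : 0 <= kappa by apply: sumr_ge0.
have kappa_le : kappa <= sigma by apply: ler_sum.
have SE : S = kappa / sigma.
  rewrite /S /sobol_index /mxtrace; congr (_ / _); apply: eq_bigr => l _.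
    exact: ZE.
  exact: SigmaE.
have vE : \sum_(l < k) v l = sigma / rho ^+ 2.
  by rewrite /sigma mulr_suml; apply: eq_bigr => l _; rewrite /v SigmaE.
have W_bounded : {ae P', forall w i,
    \sum_(l < k) tnth (W i w).1 l ^+ 2 <= rho ^+ 2 /\
    \sum_(l < k) tnth (W i w).2 l ^+ 2 <= rho ^+ 2}.
  pose ball := [set x : k.-tuple R | \sum_(l < k) tnth x l ^+ 2 <= rho ^+ 2].
  have mball : measurable ball.
    rewrite -[ball]setTI; apply: measurable_fun_le => //.
    by apply: measurable_sum => l; apply: measurable_funX; exact: measurable_tnth.
  (* Y^u has the law of Y, so it too lies in the ball almost surely; equality of laws then transmits
     this from the pair to each [W i]. *)
  have Yu_ball : {ae P, forall w, ball (Yu w)}.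
    have mbad : measurable (f @^-1` ~` ball).
      by rewrite -[X in measurable X]setTI; apply: f_meas => //; exact: measurableC.
    have mYbad (h : T -> k.-tuple R) : measurable_fun setT h -> measurable (~` [set w | ball (h w)]).
      move=> mh; rewrite -[X in measurable X]setTI; apply: (mh _ (~` ball)) => //.
      exact: measurableC.
    apply: (negligibleP P (mYbad _ mYu)).2; rewrite -[RHS]((negligibleP P (mYbad _ mY)).1 Y_ball).
    exact: (joint_freeze_law mX mX' X_indep X'_copy X'_indep mbad).
  pose both := [set x : k.-tuple R * k.-tuple R | ball x.1 /\ ball x.2].
  have mboth : measurable (~` both).
    have bothE : both = (setT `&` fst @^-1` ball) `&` (setT `&` snd @^-1` ball).
      by rewrite !setTI.
    rewrite bothE; apply: measurableC; apply: measurableI.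
      exact: measurable_fst.
    exact: measurable_snd.
  have W_both i : {ae P', forall w, both (W i w)}.
    have mWbad : measurable (~` [set w | both (W i w)]).
      by rewrite -[X in measurable X]setTI; exact: (mW i _ _ mboth).
    apply: (negligibleP P' mWbad).2.
    have mYYu : measurable (~` [set w | both (Y w, Yu w)]).
      rewrite -[X in measurable X]setTI.
      exact: (measurable_fun_pair mY mYu measurableT mboth).
    have YYu_both : {ae P, forall w, both (Y w, Yu w)}.
      by apply: filterS2 Y_ball Yu_ball.
    by rewrite -[RHS]((negligibleP P mYYu).1 YYu_both); exact: (W_law i _ mboth).
  exact: filter_forall W_both.
(* [rho + rho ^+ 2] is a common bound for the half sums, at most rho, and for the squares, at most
   rho^2. *)
have transfer (phi : k.-tuple R * k.-tuple R -> R) i : measurable_fun setT phi ->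
    (forall x, `|phi x| <= rho + rho ^+ 2) ->
    \int[P']_w phi (W i w) = \int[P]_w phi (Y w, Yu w).
  move=> mphi phiM.
  apply: (same_law_Rintegral (X1 := W i) (X2 := fun w => (Y w, Yu w)) _ _ mphi phiM) => //.
  exact: measurable_fun_pair.
have rho2 : 0 <= rho ^+ 2 by exact: sqr_ge0.
have half_sum_mean i l : \int[P']_w half_sum rho (W i w) l = m l.
  rewrite (transfer (fun x => half_sum rho x l)).
  - exact: (Rintegral_half_sum_freeze mX mX' X_indep X'_copy X'_indep (mg l) (gM l)).
  - exact: measurable_half_sum.
  - by move=> x; rewrite (le_trans (half_sum_le rho_gt0 _ _))// lerDl.
have half_sum_sqr i l : \int[P']_w half_sum rho (W i w) l ^+ 2 = (A l + B l) / 2.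
  rewrite (transfer (fun x => half_sum rho x l ^+ 2)).
  - exact: (Rintegral_half_sum_sqr_freeze mX mX' X_indep X'_copy X'_indep (mg l) (gM l) (zM l) (yz l)).
  - by apply: measurable_funX; exact: measurable_half_sum.
  - move=> x; rewrite normrX (@le_trans _ _ (rho ^+ 2))// ?lerDr ?(ltW rho_gt0)//.
    by rewrite ler_sqr ?nnegrE ?(ltW rho_gt0)// half_sum_le.
have half_diff_sqr i l : \int[P']_w half_diff rho (W i w) l ^+ 2 = (A l - B l) / 2.
  rewrite (transfer (fun x => half_diff rho x l ^+ 2)).
  - exact: half_diff_moment.
  - by apply: measurable_funX; exact: measurable_half_diff.
  - move=> x; rewrite normrX (@le_trans _ _ (rho ^+ 2))// ?lerDr ?(ltW rho_gt0)//.
    by rewrite ler_sqr ?nnegrE ?(ltW rho_gt0)// half_diff_le.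
(* For sigma = 0 the factor [\sum_(l < k) v l] vanishes and both bounds equal 1. This covers k = 0,
   where positive definiteness is vacuous. *)
have [sigma0|sigma0] := eqVneq sigma 0.
  rewrite vE sigma0 mul0r; split=> t _; rewrite mulr0 expr0n mulr0 oppr0 expR0.
  - apply: probability_le1.
    rewrite (_ : [set w | _] = [set w | S + t <= pick_freeze (fun i => W i w)]).
      exact: measurable_pick_freeze_ge.
    by apply/seteqP; split=> w /=; rewrite lerBrDl.
  - apply: probability_le1.
    rewrite (_ : [set w | _] = [set w | pick_freeze (fun i => W i w) <= S - t]).
      exact: measurable_pick_freeze_le.
    by apply/seteqP; split=> w /=; rewrite lerBlDr [- t + S]addrC.
have sigma_gt0 : 0 < sigma.
  by rewrite lt_neqAle eq_sym sigma0 (le_trans kappa_ge0).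
have S_ge0 : 0 <= S by rewrite SE divr_ge0// ltW.
have S_le1 : S <= 1 by rewrite SE ler_pdivrMr// mul1r.
have kappaE : kappa = S * sigma by rewrite SE divfK.
rewrite vE; split=> t tS.
- exact: (pick_freeze_upper_tail N_gt0 rho_gt0 mW W_indep W_bounded
    half_sum_mean half_sum_sqr half_diff_sqr sigma_gt0 S_ge0 S_le1 kappaE tS).
- exact: (pick_freeze_lower_tail N_gt0 rho_gt0 mW W_indep W_bounded
    half_sum_mean half_sum_sqr half_diff_sqr sigma_gt0 S_ge0 S_le1 kappaE tS).
Qed.
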